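(* Let $F(u,v)$ denote any of the four Nevanlinna functions $A,B,C,D$ on $\mathbb{C}^2$ of an indeterminate Hamburger moment problem. For $v\in\mathbb{C}$ define $$Z(F)_v:=\{u\in\mathbb{C}\mid F(u,v)=0\}.$$ Then $Z(F)_v$ is countably infinite. If $v\in\mathbb{R}$ then $Z(F)_v\subset\mathbb{R}$, and if $v$ is in either the open upper or the open lower half-plane, then $Z(F)_v$ is contained in the same half-plane.
   Context: Setting: $s=(s_n)_{n\ge0}$, $s_0=1$, is an indeterminate Hamburger moment sequence, i.e. $s_n=\int x^n\,d\mu(x)$ for all $n\ge 0$ for more than one positive measure $\mu$ on $\mathbb{R}$ (with infinite support); $V$ is the set of all such $\mu$. $(p_n)_{n\ge0}$ are the orthonormal polynomials ($\deg p_n=n$, positive leading coefficient, $p_0=1$, $\int p_np_m\,d\mu=\delta_{n,m}$). The polynomials of the second kind are $q_n(z)=\int\frac{p_n(z)-p_n(x)}{z-x}\,d\mu(x)$, $\mu\in V$ arbitrary. It is known that $(p_n(z))_{n\ge0}$ and $(q_n(z))_{n\ge0}$ belong to $\ell^2$ for every $z\in\mathbb{C}$. Nevanlinna functions (entire on $\mathbb{C}^2$): $A(u,v)=(u-v)\sum_{k=0}^\infty q_k(u)q_k(v)$, $B(u,v)=-1+(u-v)\sum_{k=0}^\infty p_k(u)q_k(v)$, $C(u,v)=1+(u-v)\sum_{k=0}^\infty q_k(u)p_k(v)$, $D(u,v)=(u-v)\sum_{k=0}^\infty p_k(u)p_k(v)$. *)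

(* Defs.v *)
From HB Require Import structures.
From mathcomp Require Import all_boot all_order all_algebra.
From mathcomp Require Import complex.
From mathcomp Require Import all_classical all_reals all_analysis.

Set Implicit Arguments.
Unset Strict Implicit.
Unset Printing Implicit Defensive.

Import Order.TTheory GRing.Theory Num.Theory.
Import numFieldNormedType.Exports.

Local Open Scope classical_set_scope.
Local Open Scope ring_scope.
Local Open Scope complex_scope.

Definition msupport (R : realType)
    (mu : {measure set (measurableTypeR R) -> \bar R}) : set R :=
  [set x | forall U : set R, open U -> U x -> (0 < mu U)%E].

Definition moment_solution (R : realType) (s : nat -> R)
    (mu : {measure set (measurableTypeR R) -> \bar R}) : Prop :=
  infinite_set (msupport mu) /\
  forall n, mu.-integrable setT (fun x : R => (x ^+ n)%:E) /\
            (\int[mu]_x (x ^+ n)%:E = (s n)%:E)%E.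

Definition indeterminate (R : realType) (s : nat -> R) : Prop :=
  exists mu nu : {measure set (measurableTypeR R) -> \bar R},
    [/\ moment_solution s mu, moment_solution s nu &
        exists A : set (measurableTypeR R), measurable A /\ mu A <> nu A].

Definition orthonormal_polys (R : realType)
    (mu : {measure set (measurableTypeR R) -> \bar R})
    (p : nat -> {poly R}) : Prop :=
  [/\ p 0%N = 1,
      forall n, size (p n) = n.+1,
      forall n, 0 < lead_coef (p n) &
      forall n m,
        (\int[mu]_x ((p n).[x] * (p m).[x])%:E = ((n == m)%:R : R)%:E)%E].

Definition ceval (R : realType) (p : {poly R}) (z : R[i]) : R[i] :=
  (map_poly (real_complex R) p).[z].

(* (p(z) - p(x)) / (z - x), with the removable singularity at z = x filled in:
   for real z the measure may have an atom at z. *)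
Definition divided_difference (R : realType) (p : {poly R}) (z : R[i]) (x : R)
    : R[i] :=
  if z == x%:C then ceval p^`() z
  else (ceval p z - ceval p x%:C) / (z - x%:C).

Definition cintegral (R : realType)
    (mu : {measure set (measurableTypeR R) -> \bar R}) (f : R -> R[i]) : R[i] :=
  (\int[mu]_x complex.Re (f x)) +i* (\int[mu]_x complex.Im (f x)).

Definition second_kind (R : realType)
    (mu : {measure set (measurableTypeR R) -> \bar R})
    (p : nat -> {poly R}) (n : nat) (z : R[i]) : R[i] :=
  cintegral mu (divided_difference (p n) z).

Definition cseries (R : realType) (f : nat -> R[i]) : R[i] :=
  limn (series f : nat -> (R[i])^o).

Section Nevanlinna.
Variables (R : realType) (mu : {measure set (measurableTypeR R) -> \bar R}).
Variable p : nat -> {poly R}.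
Implicit Types u v : R[i].

Let P n z := ceval (p n) z.
Let Q n z := second_kind mu p n z.

Definition nevanlinnaA u v : R[i] :=
  (u - v) * cseries (fun k => Q k u * Q k v).

Definition nevanlinnaB u v : R[i] :=
  -1 + (u - v) * cseries (fun k => P k u * Q k v).

Definition nevanlinnaC u v : R[i] :=
  1 + (u - v) * cseries (fun k => Q k u * P k v).

Definition nevanlinnaD u v : R[i] :=
  (u - v) * cseries (fun k => P k u * P k v).

End Nevanlinna.

Definition zero_section (R : realType) (F : R[i] -> R[i] -> R[i]) (v : R[i])
    : set R[i] := [set u | F u v = 0].

(* Main.v *)
Require Import Defs.
From HB Require Import structures.
From mathcomp Require Import all_boot all_order all_algebra.
From mathcomp Require Import complex.
From mathcomp Require Import all_classical all_reals all_analysis.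
From mathcomp Require Import separable measurable_realfun.
From mathcomp Require Import ring lra.

Import Order.TTheory GRing.Theory Num.Theory.
Import numFieldNormedType.Exports.

Local Open Scope classical_set_scope.
Local Open Scope ring_scope.
Local Open Scope complex_scope.

(** Fix [v] and let [X], [Y] range over the two families of solutions
    [p_k(u)], [q_k(u)] of the three-term recurrence.  By Christoffel-Darboux the
    [n]-th partial sum of each of the four functions is a bracket
    [E_n(u) = b_n (X_(n+1)(u) Y_n(v) - X_n(u) Y_(n+1)(v))] of two solutions
    ([bracket_sol]); the four choices of [X] and [Y] give A, B, C and D, and all
    of them are treated at once ([nevF]).

    Square summability.  Everything rests on [p_k(z)] and [q_k(z)] being square
    summable for every complex [z].  If two solutions of the moment problem gave
    the same integral to [1 / (x - z)] for all nonreal [z], partial fractions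
    would give them the same integral of [1 / (1 + n y^(2n))], where [y] is a
    real affine function of [x]; these functions tend to the indicator of an
    open interval, so the two measures would coincide ([same_measure]).  Hence
    the integrals [W1], [W2] differ at some [z].  The Fourier coefficients of
    [1 / (x - z)] are [q_k(z) + p_k(z) W1] for the first measure and
    [q_k(z) + p_k(z) W2] for the second, so Bessel's inequality makes [p_k(z)]
    and [q_k(z)] square summable, and variation of constants carries this to all
    other points ([l2_transfer], [l2_solutions]).

    Location of the zeros.  The Pluecker relation between the brackets of four
    vectors of the plane, applied to [X(u)], [X(conj u)], [Y(v)], [Y(conj v)],
    yields [|E_n(u)|^2 - |E_n(conj u)|^2 = - 4 Im u Im v S T] with [S], [T]
    positive.  Combined with the same relation for [Y(v)] and its complementary
    solution, it excludes zeros in the lower half-plane when [Im v >= 0], for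
    [E_n] and for the limit ([bracket_neq0], [nevF_neq0]).  Conjugation and a
    third instance of the relation ([nevF_real_neq0]) settle the other cases.

    Number of zeros.  Let [Im v >= 0].  With [u = -i + t] the polynomial [E_n]
    is a constant times a product of factors [1 - a t] with [Im a <= 0].  For
    such a product the values at three points control the sum of the [a] and the
    sum of the [|a|^2] ([tame_of_values]), uniformly in [n] by convergence.  These two
    bounds give what is needed of Hurwitz's theorem: a disc contains finitely
    many zeros of the limit.  If the limit had finitely many zeros in all, then
    all but a bounded number of the [a] would tend to [0], and [E_n(x - i)] would
    be a polynomially bounded quantity times some [exp (- beta_n x)]; a Gaussian
    factor cannot appear since the [a] stay in a half-plane.  So the limit [F]
    would be polynomially bounded on one half of the line [Im u = -1]
    ([poly_bound_of_finite_zeros]).  But on that line the Pluecker relation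
    bounds the sum of all [|X_k(u)|^2] by [K (1 + x^2) |F(u)|^2]
    ([energy_growth]), and the [X_k] are polynomials of unbounded degree. *)

Set Implicit Arguments.
Unset Strict Implicit.
Unset Printing Implicit Defensive.

(** * Squared modulus of complex numbers *)

Section NormSquare.
Variable R : realType.
Implicit Types z w : R[i].

Definition normsq z : R := complex.Re z ^+ 2 + complex.Im z ^+ 2.

Lemma normsq_ge0 z : 0 <= normsq z.
Proof. by rewrite addr_ge0 ?sqr_ge0. Qed.

Lemma normsqM z w : normsq (z * w) = normsq z * normsq w.
Proof. by case: z w => a b [c d]; rewrite /normsq /=; ring. Qed.

Lemma normsqN z : normsq (- z) = normsq z.
Proof. by case: z => a b; rewrite /normsq /= !sqrrN. Qed.

Lemma normsq0 : normsq 0 = 0.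
Proof. by rewrite /normsq /=; ring. Qed.

Lemma normsq1 : normsq 1 = 1.
Proof. by rewrite /normsq /=; ring. Qed.

Lemma normsqJ z : normsq z^* = normsq z.
Proof. by case: z => a b; rewrite /normsq /= sqrrN. Qed.

Lemma normsq_real (x : R) : normsq x%:C = x ^+ 2.
Proof. by rewrite /normsq /=; ring. Qed.

Lemma normsq_eq0 z : (normsq z == 0) = (z == 0).
Proof.
case: z => a b; rewrite /normsq /= paddr_eq0 ?sqr_ge0 // !sqrf_eq0.
by rewrite eq_complex.
Qed.

Lemma normsq_gt0 z : (0 < normsq z) = (z != 0).
Proof. by rewrite lt_def normsq_ge0 andbT normsq_eq0. Qed.

Lemma normsqV z : normsq z^-1 = (normsq z)^-1.
Proof.
have [->|z0] := eqVneq z 0; first by rewrite invr0 normsq0 invr0.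
apply: (mulIf (_ : normsq z != 0)); first by rewrite normsq_eq0.
by rewrite -normsqM !mulVf ?normsq_eq0// normsq1.
Qed.

Lemma normsq_prod (I : Type) (r : seq I) (P : pred I) (F : I -> R[i]) :
  normsq (\prod_(i <- r | P i) F i) = \prod_(i <- r | P i) normsq (F i).
Proof. exact: (big_morph _ normsqM normsq1). Qed.

Lemma normsq_le2 z w : normsq (z + w) <= 2 * normsq z + 2 * normsq w.
Proof.
case: z w => a b [c d]; rewrite /normsq /=.
have := sqr_ge0 (a - c); have := sqr_ge0 (b - d); lra.
Qed.

Lemma sqr_Re_le z : complex.Re z ^+ 2 <= normsq z.
Proof. by rewrite lerDl sqr_ge0. Qed.

Lemma Re_le_normsq z : `|complex.Re z| <= (1 + normsq z) / 2.
Proof.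
have := sqr_Re_le z; set a := complex.Re z => h; rewrite ler_norml.
by have := sqr_ge0 (a - 1); have := sqr_ge0 (a + 1); move=> *; apply/andP; split; nra.
Qed.

Lemma mulJ_normsq z : z * z^* = (normsq z)%:C.
Proof. by case: z => a b; apply/eqP; rewrite eq_complex /normsq /=; apply/andP; split; apply/eqP; ring. Qed.

Lemma normsq_1B_le z :
  normsq (1 - z) <= expR (- 2 * complex.Re z + normsq z).
Proof.
apply: le_trans (expR_ge1Dx _).
by case: z => a b; rewrite /normsq /=; lra.
Qed.

(** The estimate [normsq_1B_le] is reversed with the help of [|1 - z| |1 + z| >=
    1 - |z|^2] when [z] is small; for the other [z] a large [k] makes up for
    the size of the exponential. *)
Lemma normsq_1B_ge (e : R) : 0 < e ->
  exists2 k, 0 <= k &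
    forall z, e <= normsq (1 - z) ->
      expR (- 2 * complex.Re z - k * normsq z) <= normsq (1 - z).
Proof.
move=> e0; exists (5 + 4 * `|ln e|); first by rewrite addr_ge0 ?mulr_ge0.
move=> z ez; have s0 := normsq_ge0 z; set s := normsq z in s0 *.
have l0 : 0 <= `|ln e| by [].
have [s4|s4] := leP s (1 / 4); last first.
  apply: le_trans ez; rewrite -[leRHS](lnK e0) ler_expR.
  apply: le_trans (lerNnormlW (lexx `|ln e|)).
  have : - ((1 + s) / 2) <= complex.Re z by apply: lerNnormlW; exact: Re_le_normsq.
  by move: s4 l0; move: `|ln e| => l; nra.
have h1 : (1 - s) ^+ 2 <= normsq (1 - z) * normsq (1 + z).
  rewrite -normsqM; have -> : (1 - z) * (1 + z) = 1 - z * z by ring.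
  have : complex.Re (z * z) <= s.
    by rewrite /s /normsq; case: (z) => a b /=; have := sqr_ge0 b; nra.
  have : normsq (z * z) = s ^+ 2 by rewrite normsqM.
  by move: (z * z) => [c d]; rewrite /normsq /= => h1 h2; nra.
have h2 : normsq (1 + z) <= expR (2 * complex.Re z + s).
  have := normsq_1B_le (- z); rewrite opprK normsqN -/s.
  by congr (_ <= expR _); case: (z) => a b /=; ring.
have h3 : expR (- 2 * s) <= 1 - s.
  have := expR_ge1Dx (2 * s); rewrite mulNr expRN.
  move=> h; rewrite -lef_pV2 ?invrK ?posrE ?invr_gt0 ?expR_gt0//; last by lra.
  apply: le_trans h; rewrite -[leLHS]mul1r ler_pdivrMr; last by lra.
  by nra.
have h4 : expR (- 2 * complex.Re z - s) * (1 - s) ^+ 2 <= normsq (1 - z).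
  have -> : - 2 * complex.Re z - s = - (2 * complex.Re z + s) by ring.
  rewrite expRN mulrC ler_pdivrMr ?expR_gt0//.
  by apply: (le_trans h1); rewrite ler_wpM2l ?normsq_ge0.
apply: le_trans h4; have -> : - 2 * complex.Re z - (5 + 4 * `|ln e|) * s =
  (- 2 * complex.Re z - s) + ((- 2 * s) + (- 2 * s) - 4 * `|ln e| * s) by ring.
rewrite expRD ler_wpM2l ?expR_ge0// expRD -[leRHS]mulr1.
apply: ler_pM; rewrite ?expR_ge0//.
  by rewrite expRD expr2; apply: ler_pM; rewrite ?expR_ge0.
by rewrite -expR0 ler_expR oppr_le0 !mulr_ge0.
Qed.

End NormSquare.

(** * Finite products of linear factors *)

Section LinearFactors.
Variable R : realType.
Local Notation C := R[i].
Implicit Types (T : seq C) (t a : C).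

Definition linprod T t : C := \prod_(a <- T) (1 - a * t).

(** The bounds under which products of linear factors behave like [exp (- t sum
    a)] up to factors [exp (O(|t|^2))], uniformly in the number of factors. *)
Definition tame (M : R) T : Prop :=
  [/\ {in T, forall a : C, complex.Im a <= 0}, \sum_(a <- T) normsq a <= M,
      normsq (\sum_(a <- T) a) <= M & \sum_(a <- T) - complex.Im a <= M].

Lemma Re_sum (I : Type) (r : seq I) (P : pred I) (F : I -> C) :
  complex.Re (\sum_(i <- r | P i) F i) = \sum_(i <- r | P i) complex.Re (F i).
Proof. by apply: (big_morph (@complex.Re R)) => // -[a b] [c d]. Qed.

Lemma Im_sum (I : Type) (r : seq I) (P : pred I) (F : I -> C) :
  complex.Im (\sum_(i <- r | P i) F i) = \sum_(i <- r | P i) complex.Im (F i).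
Proof. by apply: (big_morph (@complex.Im R)) => // -[a b] [c d]. Qed.

Lemma normsq_linprod T t :
  normsq (linprod T t) = \prod_(a <- T) normsq (1 - a * t).
Proof. exact: normsq_prod. Qed.

(** The point [- 'i] lies on the side of the real axis without poles of [1 / (1
    - a t)], so that every factor is at least [1] there. *)
Lemma linprod_Ni_ge T : {in T, forall a : C, complex.Im a <= 0} ->
  1 + \sum_(a <- T) (normsq a - 2 * complex.Im a) <= normsq (linprod T (- 'i)).
Proof.
rewrite normsq_linprod; elim: T => [|a T ih] hT; first by rewrite !big_nil addr0.
rewrite !big_cons.
have hT' : {in T, forall a : C, complex.Im a <= 0}.
  by move=> b bT; apply: hT; rewrite in_cons bT orbT.
have -> : normsq (1 - a * - 'i) = 1 + (normsq a - 2 * complex.Im a).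
  by case: (a) => x y; rewrite /normsq /=; ring.
have h1 : 0 <= normsq a - 2 * complex.Im a.
  by have := hT a (mem_head _ _); have := normsq_ge0 a; lra.
have h2 : 0 <= \sum_(j <- T) (normsq j - 2 * complex.Im j).
  rewrite big_seq sumr_ge0 // => b bT.
  by have := hT' b bT; have := normsq_ge0 b; lra.
have := ih hT'.
set s := \sum_(j <- T) _ in h2 *; set x := _ - _ in h1 *; move=> h.
apply: (@le_trans _ _ ((1 + x) * (1 + s))); first by nra.
by rewrite ler_wpM2l // addr_ge0.
Qed.

Lemma linprod_le T t : normsq (linprod T t) <=
  expR (- 2 * complex.Re ((\sum_(a <- T) a) * t) +
        (\sum_(a <- T) normsq a) * normsq t).
Proof.
rewrite mulr_suml Re_sum mulr_sumr mulr_suml -big_split expR_sum normsq_linprod.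
apply: ler_prod => a _; rewrite normsq_ge0 /= -normsqM.
exact: normsq_1B_le.
Qed.

Lemma linprod_ge (e : R) : 0 < e ->
  exists2 k, 0 <= k &
    forall T t, {in T, forall a, e <= normsq (1 - a * t)} ->
    expR (- 2 * complex.Re ((\sum_(a <- T) a) * t) -
          k * ((\sum_(a <- T) normsq a) * normsq t)) <= normsq (linprod T t).
Proof.
move=> /normsq_1B_ge[k k0 hk]; exists k => // T t hT.
rewrite mulr_suml Re_sum mulr_sumr mulr_suml mulr_sumr -sumrB expR_sum.
rewrite normsq_linprod big_seq [leRHS]big_seq.
apply: ler_prod => a aT; rewrite expR_ge0 /= -normsqM.
by apply: hk; exact: hT.
Qed.

(** The value at [- 'i] bounds the sums of [normsq a] and of [- Im a]; the
    values at [1] and [-1] then bound the real part of the sum of the [a]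
    from both sides. *)
Lemma tame_of_values (B c : R) : 0 < c ->
  exists2 M, 0 <= M &
    forall T, {in T, forall a : C, complex.Im a <= 0} ->
      normsq (linprod T (- 'i)) <= B ->
      c <= normsq (linprod T 1) -> c <= normsq (linprod T (- 1)) -> tame M T.
Proof.
move=> c0; pose D := `|B| + `|ln c|; exists (D ^+ 2 + `|B| ^+ 2 + `|B|).
  by rewrite !addr_ge0 ?sqr_ge0.
move=> T hT hB h1 h2.
have := le_trans (linprod_Ni_ge hT) hB; rewrite sumrB.
under [X in _ - X]eq_bigr do rewrite -[complex.Im _]opprK mulrN.
rewrite sumrN opprK -mulr_sumr.
have hb : 0 <= \sum_(a <- T) - complex.Im a.
  by rewrite big_seq sumr_ge0 // => a /hT; rewrite oppr_ge0.
have hs : 0 <= \sum_(a <- T) normsq a by rewrite sumr_ge0 // => a _; rewrite normsq_ge0.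
have hD : 0 <= D by rewrite addr_ge0.
have B0 := ler_norm B.
move=> hsum.
have := le_trans h1 (linprod_le T 1); have := le_trans h2 (linprod_le T (-1)).
rewrite mulr1 mulrN1 normsqN normsq1 !mulr1.
rewrite -[X in X <= _](lnK c0) ler_expR -[X in _ -> X <= _ -> _](lnK c0) ler_expR.
have hIm : complex.Im (\sum_(a <- T) a) = - \sum_(a <- T) - complex.Im a.
  by rewrite Im_sum sumrN opprK.
have hRe : complex.Re (- \sum_(a <- T) a) = - complex.Re (\sum_(a <- T) a).
  by case: (\sum_(a <- T) a).
rewrite hRe => k2 k1; have c1 : - `|ln c| <= ln c by apply: lerNnormlW.
split => //; first by have := sqr_ge0 D; have := sqr_ge0 `|B|; lra.
  rewrite {1}/normsq hIm sqrrN.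
  set x := complex.Re _ in k1 k2 *; set y := (\sum_(a <- T) _) in hb hsum *.
  have hx : `|x| <= D by rewrite ler_norml /D; apply/andP; split; lra.
  have : x ^+ 2 <= D ^+ 2 by rewrite -real_normK ?num_real // ler_sqr ?nnegrE.
  have : y ^+ 2 <= `|B| ^+ 2 by rewrite ler_sqr ?nnegrE//; lra.
  by have := normr_ge0 B; lra.
by have := sqr_ge0 D; have := sqr_ge0 `|B|; lra.
Qed.

(** Removing one factor leaves a product that is still bounded, so that the
    whole product is small near each of its zeros. *)
Lemma linprod_le_factor (M r : R) : 0 <= M -> 0 <= r ->
  exists2 K, 0 <= K &
    forall T t a, tame M T -> normsq t <= r -> a \in T ->
      normsq (linprod T t) <= K * normsq (1 - a * t).
Proof.
move=> M0 r0; exists (expR ((1 + 4 * M * r) + M * r)); first exact: expR_ge0.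
move=> T t a [_ hs hsum _] ht aT.
rewrite {1}/linprod (big_rem a aT) /= normsqM mulrC ler_wpM2r ?normsq_ge0//.
have := linprod_le (rem a T) t; rewrite {1}/linprod => h; apply: le_trans h _.
rewrite ler_expR.
have e1 : \sum_(b <- rem a T) b = \sum_(b <- T) b - a.
  by rewrite [in RHS](big_rem a aT) /= [RHS]addrC addKr.
have e2 : \sum_(b <- rem a T) normsq b <= M.
  by apply: le_trans hs; rewrite (big_rem a aT) /= lerDr normsq_ge0.
have e3 : normsq a <= M.
  apply: le_trans hs; rewrite (big_rem a aT) /= lerDl sumr_ge0 // => b _.
  exact: normsq_ge0.
have e4 : normsq (\sum_(b <- rem a T) b) <= 4 * M.
  by rewrite e1; apply: le_trans (normsq_le2 _ _) _; rewrite normsqN; lra.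
have e5 : normsq ((\sum_(b <- rem a T) b) * t) <= 4 * M * r.
  by rewrite normsqM ler_pM ?normsq_ge0.
have := Re_le_normsq ((\sum_(b <- rem a T) b) * t).
rewrite ler_norml => /andP[e6 _].
have e7 : (\sum_(b <- rem a T) normsq b) * normsq t <= M * r.
  by rewrite ler_pM ?normsq_ge0// sumr_ge0 // => b _; exact: normsq_ge0.
lra.
Qed.

(** For large zeros the quadratic term of the logarithm on the real line is
    nonpositive up to the square of [Im a], which is absorbed by [Im a]
    itself. *)
Lemma normsq_large_factor (x : R) a :
  1 <= x ^+ 2 -> 4 * x ^+ 4 * normsq a <= 1 -> complex.Im a <= 0 ->
  normsq (1 - a * x%:C) <= expR (- 2 * x * complex.Re a - 2 * complex.Im a).
Proof.
case: a => a b /= x1 ha b0; have x0 : 0 < x ^+ 2 by lra.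
have -> : normsq (1 - (a +i* b) * x%:C) = (1 - x * a) ^+ 2 + (x * b) ^+ 2.
  by rewrite /normsq /=; ring.
move: ha; rewrite /normsq /= => ha.
have x4 : x ^+ 4 = x ^+ 2 * x ^+ 2 by ring.
have ha2 : 4 * (x * a) ^+ 2 <= 1.
  have : x ^+ 2 * a ^+ 2 <= x ^+ 4 * a ^+ 2.
    by rewrite x4 ler_wpM2r ?sqr_ge0//; nra.
  have : 0 <= x ^+ 4 * b ^+ 2 by rewrite mulr_ge0 ?sqr_ge0// x4 mulr_ge0 ?sqr_ge0.
  by rewrite exprMn; nra.
have hb2 : (2 * x ^+ 2 * - b) <= 1.
  have p0 : 0 <= 2 * x ^+ 2 * - b by nra.
  rewrite -ler_sqr ?nnegrE//.
  have : 0 <= x ^+ 4 * a ^+ 2 by rewrite mulr_ge0 ?sqr_ge0// x4 mulr_ge0 ?sqr_ge0.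
  by rewrite expr1n !exprMn sqrrN x4 -natrX; nra.
have hs : x * a <= 1 / 2.
  by have := sqr_ge0 (2 * (x * a) - 1); nra.
have hb3 : 4 * (x * b) ^+ 2 <= - 2 * b.
  have -> : 4 * (x * b) ^+ 2 = 2 * (2 * x ^+ 2 * - b) * - b by ring.
  by nra.
have -> : - 2 * x * a - 2 * b = - (x * a) + - (x * a) + - 2 * b by ring.
have g1 := expR_ge1Dx (- (x * a)); have g2 := expR_ge1Dx (- 2 * b).
have s0 : 0 <= 1 - x * a by lra.
apply: (@le_trans _ _ ((1 - x * a) * (1 - x * a) * (1 + - 2 * b))).
  have : 0 <= (x * b) ^+ 2 by exact: sqr_ge0.
  have : 1 / 4 <= (1 - x * a) ^+ 2 by nra.
  by move: hb3; move: ((x * b) ^+ 2) => y; rewrite -expr2; nra.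
rewrite !expRD; apply: ler_pM => //; [by rewrite mulr_ge0| by lra|].
by apply: ler_pM.
Qed.

End LinearFactors.

(** * Convergence of complex sequences and zeros of limits of products *)

Section ComplexLimits.
Variable R : realType.
Local Notation C := R[i].
Implicit Types (u w : nat -> C) (k l : C).

Lemma ReD (z w : C) : complex.Re (z + w) = complex.Re z + complex.Re w.
Proof. by case: z w => ? ? []. Qed.

Lemma ImD (z w : C) : complex.Im (z + w) = complex.Im z + complex.Im w.
Proof. by case: z w => ? ? []. Qed.

Lemma ReM (z w : C) : complex.Re (z * w) =
  complex.Re z * complex.Re w - complex.Im z * complex.Im w.
Proof. by case: z w => ? ? []. Qed.

Lemma ImM (z w : C) : complex.Im (z * w) =
  complex.Re z * complex.Im w + complex.Im z * complex.Re w.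
Proof. by case: z w => ? ? []. Qed.

Lemma ReJ (z : C) : complex.Re z^* = complex.Re z.
Proof. by case: z. Qed.

Lemma ImJ (z : C) : complex.Im z^* = - complex.Im z.
Proof. by case: z. Qed.

(** Componentwise, so that the theory of limits of real sequences applies
    directly. *)
Definition ccvg u l : Prop :=
  complex.Re (u n) @[n --> \oo] --> complex.Re l /\
  complex.Im (u n) @[n --> \oo] --> complex.Im l.

Lemma ccvg_cst l : ccvg (fun=> l) l.
Proof. by split; exact: cvg_cst. Qed.

Lemma ccvgD u w k l : ccvg u k -> ccvg w l -> ccvg (fun n => u n + w n) (k + l).
Proof.
move=> [u1 u2] [w1 w2]; split; rewrite ?ReD ?ImD.
  by under eq_fun do rewrite ReD; exact: cvgD.
by under eq_fun do rewrite ImD; exact: cvgD.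
Qed.

Lemma ccvgM u w k l : ccvg u k -> ccvg w l -> ccvg (fun n => u n * w n) (k * l).
Proof.
move=> [u1 u2] [w1 w2]; split; rewrite ?ReM ?ImM.
  by under eq_fun do rewrite ReM; apply: cvgB; exact: (@cvgM R).
by under eq_fun do rewrite ImM; apply: cvgD; exact: (@cvgM R).
Qed.

Lemma ccvgN u l : ccvg u l -> ccvg (fun n => - u n) (- l).
Proof.
move=> hu; rewrite -mulN1r; under eq_fun do rewrite -mulN1r.
by apply: ccvgM => //; exact: ccvg_cst.
Qed.

Lemma ccvgB u w k l : ccvg u k -> ccvg w l -> ccvg (fun n => u n - w n) (k - l).
Proof. by move=> hu hw; apply: ccvgD => //; exact: ccvgN. Qed.

Lemma ccvgJ u l : ccvg u l -> ccvg (fun n => (u n)^*) l^*.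
Proof.
move=> [u1 u2]; split; rewrite ?ReJ ?ImJ.
  by under eq_fun do rewrite ReJ.
by under eq_fun do rewrite ImJ; exact: cvgN.
Qed.

Lemma ccvg_unique u k l : ccvg u k -> ccvg u l -> k = l.
Proof.
move=> [u1 u2] [v1 v2]; apply/eqP; rewrite eq_complex.
by rewrite (cvg_unique _ u1 v1)// (cvg_unique _ u2 v2)// !eqxx.
Qed.

Lemma ccvg_normsq u l : ccvg u l -> normsq (u n) @[n --> \oo] --> normsq l.
Proof.
move=> [u1 u2]; rewrite /normsq.
by rewrite !expr2; under eq_fun do rewrite !expr2; apply: cvgD; exact: (@cvgM R).
Qed.

Lemma ReV (z : C) : complex.Re z^-1 = complex.Re z / normsq z.
Proof. by case: z. Qed.

Lemma ImV (z : C) : complex.Im z^-1 = - (complex.Im z / normsq z).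
Proof. by case: z. Qed.

Lemma ccvgV u l : l != 0 -> ccvg u l -> ccvg (fun n => (u n)^-1) l^-1.
Proof.
move=> l0 ul; have /ccvg_normsq hl := ul; case: ul => u1 u2.
have n0 : normsq l != 0 by rewrite normsq_eq0.
split; rewrite ?ReV ?ImV.
  by under eq_fun do rewrite ReV; apply: (@cvgM R) => //; exact: cvgV.
under eq_fun do rewrite ImV.
by apply: cvgN; apply: (@cvgM R) => //; exact: cvgV.
Qed.

Lemma near_in_seq (I : eqType) (s : seq I) (P : nat -> I -> Prop) :
  (forall i, i \in s -> \forall n \near \oo, P n i) ->
  \forall n \near \oo, {in s, forall i, P n i}.
Proof.
elim: s => [|j s ih] h; first by near=> n.
have h1 := h j (mem_head _ _).
have h2 : \forall n \near \oo, {in s, forall i, P n i}.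
  by apply: ih => i si; apply: h; rewrite in_cons si orbT.
near=> n => i; rewrite in_cons => /orP[/eqP ->|]; first by near: n.
by move: i; near: n.
Unshelve. all: by end_near. Qed.

End ComplexLimits.

Section SequenceFacts.

Lemma ler_sum_sub (R : numDomainType) (I : eqType) (s t : seq I) (F : I -> R) :
  (forall i, 0 <= F i) -> uniq s -> {subset s <= t} ->
  \sum_(i <- s) F i <= \sum_(i <- t) F i.
Proof.
move=> F0; elim: s t => [|i s ih] t /=; first by rewrite big_nil sumr_ge0.
move=> /andP[si us] st; rewrite big_cons (big_rem i (st i (mem_head _ _))) /=.
rewrite lerD2l; apply: ih => // j js; apply: rem_mem.
  by apply: contraNneq si => <-.
by apply: st; rewrite in_cons js orbT.
Qed.

Lemma seq_pos_lb (R : realDomainType) (s : seq R) :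
  exists2 d : R, 0 < d & {in s, forall x, 0 < x -> d <= x}.
Proof.
elim: s => [|y s [d d0 h]]; first by exists 1.
have [y0|y0] := ltP 0 y; last first.
  exists d => // x; rewrite in_cons => /orP[/eqP ->|/h//].
  by rewrite ltNge y0.
exists (Num.min d y); first by rewrite lt_min d0 y0.
move=> x; rewrite in_cons ge_min => /orP[/eqP ->|xs x0]; first by rewrite lexx orbT.
by rewrite h.
Qed.

End SequenceFacts.

Section ZerosOfLimits.
Variables (R : realType) (T : nat -> seq R[i]) (f : R[i] -> R[i]).
Local Notation C := R[i].
Hypothesis T_lower : forall n, {in T n, forall a : C, complex.Im a <= 0}.
Hypothesis T_cvg : forall t, ccvg (fun n => linprod (T n) t) (f t).
Hypothesis f1 : f 1 != 0.
Hypothesis fN1 : f (- 1) != 0.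

Let near_lt t c : normsq (f t) < c ->
  \forall n \near \oo, normsq (linprod (T n) t) < c.
Proof. by move=> h; exact: (cvgr_lt _ (ccvg_normsq (T_cvg t))). Qed.

Let near_gt t c : c < normsq (f t) ->
  \forall n \near \oo, c < normsq (linprod (T n) t).
Proof. by move=> h; exact: (cvgr_gt _ (ccvg_normsq (T_cvg t))). Qed.

Lemma eventually_tame :
  exists2 M, 0 <= M & \forall n \near \oo, tame M (T n).
Proof.
pose c := Num.min (normsq (f 1)) (normsq (f (- 1))).
have c0 : 0 < c by rewrite lt_min !normsq_gt0 f1.
have [M M0 hM] := @tame_of_values R (normsq (f (- 'i)) + 1) (c / 2) (divr_gt0 c0 (ltr0Sn _ 1)).
exists M => //; near=> n; apply: hM; first exact: T_lower.
- by apply: ltW; near: n; apply: near_lt; rewrite ltrDl.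
- apply: ltW; near: n; apply: near_gt.
  by apply: (@lt_le_trans _ _ c); [lra | rewrite ge_min lexx].
- apply: ltW; near: n; apply: near_gt.
  by apply: (@lt_le_trans _ _ c); [lra | rewrite ge_min lexx orbT].
Unshelve. all: by end_near. Qed.

(** Hurwitz's theorem in one direction: if all factors stayed away from [0] at
    [w], [linprod_ge] would keep the products away from [0]. *)
Lemma zero_near_factor w (e : R) : f w = 0 -> 0 < e ->
  \forall n \near \oo, exists2 a, a \in T n & normsq (1 - a * w) < e.
Proof.
move=> fw e0; have [M M0 tM] := eventually_tame.
have [k k0 hk] := linprod_ge e0.
have w0 := normsq_ge0 w.
pose c := expR (- (1 + M * normsq w) - k * (M * normsq w)).
near=> n; apply: contrapT => hn.
have : normsq (linprod (T n) w) < c.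
  by near: n; apply: near_lt; rewrite fw normsq0 expR_gt0.
apply/negP; rewrite -leNgt.
have [_ h1 h2 _] : tame M (T n) by near: n.
have hT : {in T n, forall a, e <= normsq (1 - a * w)}.
  by move=> a aT; rewrite leNgt; apply/negP => h; apply: hn; exists a.
apply: le_trans (hk _ _ hT); rewrite ler_expR.
apply: lerB; last by rewrite ler_wpM2l// ler_wpM2r.
have := Re_le_normsq ((\sum_(a <- T n) a) * w).
rewrite normsqM ler_norml => /andP[_ h3].
have : normsq (\sum_(a <- T n) a) * normsq w <= M * normsq w by rewrite ler_wpM2r.
lra.
Unshelve. all: by end_near. Qed.

(** Hurwitz's theorem in the other direction, from [linprod_le_factor]. *)
Lemma nonzero_far_factor t : f t != 0 ->
  exists2 d : R, 0 < d &
    \forall n \near \oo, {in T n, forall a, d <= normsq (1 - a * t)}.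
Proof.
move=> ft; have [M M0 tM] := eventually_tame.
have [K K0 hK] := linprod_le_factor M0 (normsq_ge0 t).
have f0 : 0 < normsq (f t) by rewrite normsq_gt0.
have K1 : 0 < 2 * (K + 1) by lra.
exists (normsq (f t) / (2 * (K + 1))); first by rewrite divr_gt0.
near=> n => a aT; rewrite ler_pdivrMr//.
have h1 : normsq (f t) / 2 < normsq (linprod (T n) t).
  by near: n; apply: near_gt; lra.
have h2 : tame M (T n) by near: n.
have := hK _ _ _ h2 (lexx _) aT.
have := normsq_ge0 (1 - a * t); nra.
Unshelve. all: by end_near. Qed.

(** Distinct zeros [w] of the limit are approached by distinct zeros of the
    products, that is by distinct [a] close to [1 / w], and the sum of the
    [normsq a] is bounded. *)
Lemma finite_zeros_in_disc (r : R) :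
  finite_set [set t | f t = 0 /\ normsq t <= r].
Proof.
apply: contrapT => inf; have [M M0 tM] := eventually_tame.
pose q := 1 + `|r|; have q1 : 1 <= q by rewrite lerDl.
have [B BZ sB] := infinite_set_fset (Num.trunc (4 * q * M)).+1 inf.
pose s := finmap.enum_fset B.
have sZ w : w \in s -> f w = 0 /\ normsq w <= q.
  move=> ws; have [fw wr] := BZ w ws; split => //.
  by apply: (le_trans wr); have := ler_norm r; rewrite /q; lra.
have [d d0 hd] := seq_pos_lb [seq normsq (z - w) | z <- s, w <- s].
(* below the first bound [a] is comparable with [1 / w]; below the second one a
   single [a] cannot serve two distinct zeros, which are [sqrt d] apart *)
pose e := Num.min (1 / 4) (d / (8 * q)).
have e0 : 0 < e by rewrite lt_min; apply/andP; split; [lra | rewrite divr_gt0//; lra].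
have e4 : e <= 1 / 4 by rewrite ge_min lexx.
have ed : 4 * q * e < d.
  have : e <= d / (8 * q) by rewrite ge_min lexx orbT.
  by rewrite ler_pdivlMr; [nra | lra].
have : \forall n \near \oo, {in s, forall w, exists2 a, a \in T n & normsq (1 - a * w) < e}.
  by apply: near_in_seq => w /sZ[fw _]; exact: zero_near_factor.
move=> hs; have [n [hn tn]] : exists n, {in s, forall w, exists2 a, a \in T n & normsq (1 - a * w) < e} /\ tame M (T n).
  by apply: (@filter_ex _ \oo); near=> n; split; near: n.
have /choice[g hg] : forall w, exists a, w \in s -> a \in T n /\ normsq (1 - a * w) < e.
  move=> w; case: (boolP (w \in s)) => ws; last by exists 0.
  by have [a ? ?] := hn _ ws; exists a.
have g_inj : {in s &, injective g}.
  move=> z w zs ws ezw; apply/eqP; rewrite -subr_eq0 -normsq_eq0.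
  apply: contraT => nz.
  have : d <= normsq (z - w).
    by apply: hd; [exact: allpairs_f | rewrite lt_def nz normsq_ge0].
  have -> : z - w = z * (1 - g w * w) + - (w * (1 - g w * z)) by ring.
  have [_ h1] := hg _ zs; have [_ h2] := hg _ ws; rewrite ezw in h1.
  have [_ h3] := sZ _ zs; have [_ h4] := sZ _ ws.
  have := normsq_le2 (z * (1 - g w * w)) (- (w * (1 - g w * z))).
  rewrite normsqN !normsqM.
  have : normsq z * normsq (1 - g w * w) <= q * e.
    by rewrite ler_pM ?normsq_ge0// ltW.
  have : normsq w * normsq (1 - g w * z) <= q * e.
    by rewrite ler_pM ?normsq_ge0// ltW.
  by lra.
have us : uniq (map g s) by rewrite map_inj_in_uniq ?finmap.fset_uniq.
have gT : {subset map g s <= T n} by move=> _ /mapP[w ws ->]; have [] := hg _ ws.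
have := ler_sum_sub (@normsq_ge0 R) us gT; rewrite big_map => hsum.
have [_ hM _ _] := tn.
have : \sum_(w <- s) (4 * q)^-1 <= M.
  apply: (le_trans _ hM); apply: (le_trans _ hsum).
  rewrite [leLHS]big_seq [leRHS]big_seq; apply: ler_sum => w ws.
  have [_ h1] := hg _ ws; have [_ h2] := sZ _ ws.
  have := normsq_le2 (1 - g w * w) (g w * w); rewrite subrK normsq1 normsqM.
  have := normsq_ge0 (g w) => h3.
  have : normsq (g w) * normsq w <= normsq (g w) * q by rewrite ler_wpM2l.
  rewrite -[_^-1]mul1r ler_pdivrMr; last by lra.
  by lra.
rewrite big_const_seq count_predT iter_addr_0 -[_ *+ _]mulr_natr mulrC.
rewrite ler_pdivrMr; last by lra.
apply/negP; rewrite -ltNge mulrC.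
apply: (@lt_le_trans _ _ (Num.trunc (4 * q * M)).+1%:R); first exact: truncnS_gt.
by rewrite ler_nat.
Unshelve. all: by end_near. Qed.

End ZerosOfLimits.

(** * Limits with finitely many zeros *)

Section FinitelyManyZeros.
Variables (R : realType) (T : nat -> seq R[i]) (f : R[i] -> R[i]).
Local Notation C := R[i].
Hypothesis T_lower : forall n, {in T n, forall a : C, complex.Im a <= 0}.
Hypothesis T_cvg : forall t, ccvg (fun n => linprod (T n) t) (f t).
Hypothesis f1 : f 1 != 0.
Hypothesis fN1 : f (- 1) != 0.
Variable r : R.
Hypothesis r_gt0 : 0 < r.
Hypothesis zeros_lt : forall t, f t = 0 -> normsq t < r.

(** Compactness makes [nonzero_far_factor] uniform on a bounded region that
    contains no zero of the limit. *)
Lemma no_factor_in_annulus (q : R) :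
  \forall n \near \oo, {in T n, forall a : C,
    r * normsq a <= 1 -> 1 <= q * normsq a -> False}.
Proof.
have [M M0 tM] := eventually_tame T_lower T_cvg f1 fN1.
pose p := (1 + `|q|) / 2.
have cK : compact (`[- p, p] `*` `[- p, p]) by apply: compact_setX; exact: segment_compact.
pose P n (z : R * R) := {in T n, forall a : C,
  r <= normsq (z.1 +i* z.2) -> a * (z.1 +i* z.2) != 1}.
have : \forall n \near \oo, (`[- p, p] `*` `[- p, p]) `<=` P n.
  move/compact_near_coveringP : cK => /(_ _ \oo P _); apply.
  move=> [x y] _ /=.
  have cvn (a b : R) : normsq ((z.1 - a) +i* (z.2 - b)) @[z --> (x, y)] -->
      normsq ((x - a) +i* (y - b)).
    rewrite /normsq /= !expr2; under eq_fun do rewrite !expr2.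
    by apply: cvgD; apply: (@cvgM R); apply: cvgB; try exact: cvg_cst;
       [exact: cvg_fst|exact: cvg_fst|exact: cvg_snd|exact: cvg_snd].
  have [xr|xr] := ltP (normsq (x +i* y)) r.
    have h : \forall z \near (x, y), normsq ((z.1 - 0) +i* (z.2 - 0)) < r.
      by apply: (cvgr_lt _ (cvn 0 0)); rewrite !subr0.
    near=> z n => a aT; rewrite leNgt; apply: contraNneq => _.
    by rewrite -[z.1]subr0 -[z.2]subr0; near: z.
  have fx : f (x +i* y) != 0.
    by apply: contraTneq xr => /zeros_lt; rewrite -ltNge.
  have [d d0 hd] := nonzero_far_factor T_lower T_cvg f1 fN1 fx.
  have h : \forall z \near (x, y), normsq ((z.1 - x) +i* (z.2 - y)) < d / (M + 1).
    apply: (cvgr_lt _ (cvn x y)); rewrite !subrr.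
    by rewrite (_ : 0 +i* 0 = 0 :> C) // normsq0 divr_gt0//; lra.
  near=> z n.
  have hdn : {in T n, forall a : C, d <= normsq (1 - a * (x +i* y))} by near: n.
  have [_ h2 _ _] : tame M (T n) by near: n.
  move=> a aT _; apply/eqP => az; have h1 := hdn a aT.
  have h3 : normsq ((z.1 - x) +i* (z.2 - y)) < d / (M + 1) by near: z.
  move: h1; rewrite -az -mulrBr normsqM leNgt => /negP; apply.
  rewrite (_ : _ - _ = (z.1 - x) +i* (z.2 - y))//.
  have h4 : normsq a <= M.
    apply: le_trans h2; rewrite (big_rem a aT) /= lerDl sumr_ge0 // => b _.
    exact: normsq_ge0.
  move: h3; rewrite ltr_pdivlMr; last by lra.
  have := normsq_ge0 ((z.1 - x) +i* (z.2 - y)).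
  by move: (normsq _) (normsq a) h4 => u v; nra.
move=> hP; near=> n => a aT ra qa.
have a0 : a != 0.
  by apply: contraTneq qa => ->; rewrite normsq0 mulr0 -ltNge.
have na0 : 0 < normsq a by rewrite normsq_gt0.
have h : normsq a^-1 <= `|q|.
  rewrite normsqV -[_^-1]mul1r ler_pdivrMr//; apply: (le_trans qa).
  by rewrite ler_wpM2r ?ler_norm// ltW.
have hr : r <= normsq a^-1 by rewrite normsqV -[_^-1]mul1r ler_pdivlMr.
have : P n (complex.Re a^-1, complex.Im a^-1).
  have : (`[- p, p] `*` `[- p, p]) `<=` P n by near: n.
  apply; split; rewrite /= in_itv /= -ler_norml.
    by apply: (le_trans (Re_le_normsq _)); rewrite /p; lra.
  have := Re_le_normsq (a^-1 * - 'i).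
  have -> : complex.Re (a^-1 * - 'i) = complex.Im a^-1 by case: (a^-1) => u v /=; ring.
  move/le_trans; apply; rewrite normsqM.
  have -> : normsq (- 'i : C) = 1 by rewrite /normsq /=; ring.
  by rewrite /p; lra.
move=> /(_ a aT) /=; have <- : a^-1 = complex.Re a^-1 +i* complex.Im a^-1 by case: (a^-1).
by move=> /(_ hr); rewrite mulfV ?eqxx.
Unshelve. all: by end_near. Qed.

(** All but a bounded number of the [a] are eventually as small as desired. The
    squared modulus of their product is at most [exp (- 2 x beta)] times a
    constant on the real line, [beta] being the sum of their real parts;
    along a subsequence [beta] has a constant sign, hence the bound on the
    half line of that sign. *)
Lemma poly_bound_of_finite_zeros :
  exists2 s : R, s ^+ 2 = 1 &
  exists (K : R) (N : nat), forall x : R, 1 <= x ->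
    normsq (f (s * x)%:C) <= K * (x ^+ 2) ^+ N.
Proof.
have [M M0 tM] := eventually_tame T_lower T_cvg f1 fN1.
pose small a := r * normsq a <= 1.
pose beta n := \sum_(a <- T n | small a) complex.Re a.
have [s s1 hs] : exists2 s : R, s ^+ 2 = 1 &
    forall N, exists2 n, (N <= n)%N & 0 <= s * beta n.
  have [h|] := pselect (forall N, exists2 n, (N <= n)%N & 0 <= beta n).
    by exists 1; rewrite ?expr1n // => N; have [n] := h N; exists n => //; rewrite mul1r.
  move=> /existsNP[N hN]; exists (- 1); first by rewrite sqrrN expr1n.
  move=> N'; exists (maxn N N'); first exact: leq_maxr.
  rewrite mulN1r oppr_ge0 leNgt; apply/negP => h.
  by apply: hN; exists (maxn N N'); [exact: leq_maxl | exact: ltW].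
(* [N] bounds the number of [a] that are not small, since the [normsq a] have a
   sum of at most [M] *)
exists s => //; pose N := (Num.trunc (r * M)).+1.
exists ((2 + 2 * M) ^+ N * expR (2 * M)), N => x x1.
have x2 : 1 <= x ^+ 2 by rewrite expr2; nra.
rewrite leNgt; apply/negP => hf.
(* the annulus reaches up to modulus [2 x ^ 2], which is what
   [normsq_large_factor] asks for *)
have [N1 _ h1] : \forall n \near \oo,
   [/\ (2 + 2 * M) ^+ N * expR (2 * M) * (x ^+ 2) ^+ N < normsq (linprod (T n) (s * x)%:C),
     tame M (T n) & {in T n, forall a : C,
        r * normsq a <= 1 -> 1 <= (4 * x ^+ 4) * normsq a -> False}].
  near=> n; split; near: n; [|exact: tM|exact: no_factor_in_annulus].
  exact: (cvgr_gt _ (ccvg_normsq (T_cvg _))).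
have [n N1n sb] := hs N1.
have [] := h1 n N1n => {h1}; rewrite ltNge => /negP h1 [h2 h3 h4 h5] h6; apply: h1.
rewrite normsq_linprod (bigID (predC small)) /= mulrAC.
under [X in _ * X]eq_bigl do rewrite negbK.
have hN : r * M < N%:R by exact: truncnS_gt.
have sx2 : (s * x) ^+ 2 = x ^+ 2 by rewrite exprMn s1 mul1r.
apply: ler_pM.
- by apply: prodr_ge0 => a _; exact: normsq_ge0.
- by apply: prodr_ge0 => a _; exact: normsq_ge0.
- pose c := (2 + 2 * M) * x ^+ 2.
  have c1 : 1 <= c by rewrite /c; nra.
  apply: (@le_trans _ _ (\prod_(a <- T n | ~~ small a) c)).
    rewrite [leLHS]big_seq_cond [leRHS]big_seq_cond; apply: ler_prod => a /andP[aT _].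
    rewrite normsq_ge0 /= /c; apply: le_trans (normsq_le2 _ _) _.
    rewrite normsq1 normsqN normsqM normsq_real sx2.
    have : normsq a <= M.
      apply: le_trans h3; rewrite (big_rem a aT) /= lerDl sumr_ge0 // => b _.
      exact: normsq_ge0.
    by move: (normsq a) => u; nra.
  rewrite big_const_seq iter_mulr_1 /c -exprMn -/c ler_weXn2l//.
  rewrite -(ler_nat R); apply: le_trans (ltW hN).
  have -> : (count (fun a => ~~ small a) (T n))%:R = \sum_(a <- T n | ~~ small a) (1 : R).
    by rewrite big_const_seq iter_addr_0.
  apply: (@le_trans _ _ (r * \sum_(a <- T n) normsq a)); last first.
    by rewrite ler_wpM2l// ltW.
  rewrite mulr_sumr [leRHS](bigID small) /= -[leLHS]add0r; apply: lerD.
    by apply: sumr_ge0 => a _; rewrite mulr_ge0 ?normsq_ge0// ltW.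
  by apply: ler_sum => a; rewrite /small -ltNge => /ltW.
apply: (@le_trans _ _ (expR (- 2 * (x * (s * beta n)) +
   2 * \sum_(a <- T n | small a) - complex.Im a))).
  have -> : - 2 * (x * (s * beta n)) +
      2 * (\sum_(a <- T n | small a) - complex.Im a) =
      \sum_(a <- T n | small a) (- 2 * (s * x) * complex.Re a - 2 * complex.Im a).
    by rewrite sumrB -!mulr_sumr sumrN /beta; ring.
  rewrite expR_sum [leLHS]big_seq_cond [leRHS]big_seq_cond.
  apply: ler_prod => a /andP[aT sa]; rewrite normsq_ge0 /=.
  apply: normsq_large_factor; [by rewrite sx2 | | exact: h2].
  rewrite leNgt; apply/negP => /ltW h7; apply: (h6 a aT sa).
  have s4 : s ^+ 4 = (s ^+ 2) ^+ 2 by rewrite -exprM.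
  have <- : (s * x) ^+ 4 = x ^+ 4 by rewrite exprMn s4 s1 expr1n mul1r.
  exact: h7.
rewrite ler_expR; have xs : 0 <= x * (s * beta n) by rewrite mulr_ge0//; lra.
have : \sum_(a <- T n | small a) - complex.Im a <= M.
  apply: le_trans h5; rewrite [leRHS](bigID small) /= lerDl.
  rewrite big_seq_cond sumr_ge0 // => a /andP[aT _]; rewrite oppr_ge0.
  exact: h2.
lra.
Unshelve. all: by end_near. Qed.

End FinitelyManyZeros.

(** * Zeros of limits of polynomials *)

Section ZerosOfPolynomialLimits.
Variable R : realType.
Local Notation C := R[i].

Lemma linprod_of_poly (P : {poly C}) :
  (forall u, complex.Im u < 0 -> P.[u] != 0) ->
  exists2 T : seq C, {in T, forall a : C, complex.Im a <= 0} &
    forall t, P.[- 'i + t] = P.[- 'i] * linprod T t.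
Proof.
move=> hP; have [s Ps] := closed_field_poly_normal P.
have Pt t : P.[t] = lead_coef P * \prod_(z <- s) (t - z).
  rewrite [in LHS]Ps hornerZ horner_prod; congr (_ * _).
  by apply: eq_bigr => z _; rewrite hornerXsubC.
have hs z : z \in s -> 0 <= complex.Im z.
  move=> zs; rewrite leNgt; apply/negP => /hP; rewrite Pt.
  by rewrite (big_rem z zs) /= subrr mul0r mulr0 eqxx.
exists [seq (z + 'i)^-1 | z <- s].
  move=> _ /mapP[z zs ->]; have := hs z zs; rewrite ImV oppr_le0 => z0.
  rewrite divr_ge0 ?normsq_ge0// ImD /=; lra.
move=> t; rewrite !Pt -mulrA; congr (_ * _); rewrite /linprod big_map -big_split.
rewrite big_seq [RHS]big_seq; apply: eq_bigr => z zs /=.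
have zi : z + 'i != 0.
  apply: contraTneq (hs z zs) => h; have -> : z = - 'i by rewrite -[z]subr0 -h; ring.
  by rewrite /= oppr_ge0 ler10.
by field.
Qed.

(** Far away each factor [u - z] is at least half of the real part of [u] in
    modulus. *)
Lemma poly_lower_bound (P : {poly C}) (s : R) : P != 0 -> s ^+ 2 = 1 ->
  exists2 c : R, 0 < c & exists X : R, forall x, X <= x ->
    c * (x ^+ 2) ^+ (size P).-1 <= normsq P.[- 'i + (s * x)%:C].
Proof.
move=> P0 s1; have [zs Ps] := closed_field_poly_normal P.
have l0 : lead_coef P != 0 by rewrite lead_coef_eq0.
have -> : (size P).-1 = size zs by rewrite Ps size_scale // size_prod_XsubC.
exists (normsq (lead_coef P) * (1 / 4) ^+ size zs).
  by rewrite mulr_gt0 ?normsq_gt0// exprn_gt0.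
exists (2 * \sum_(z <- zs) `|complex.Re z|) => x hx.
rewrite Ps hornerZ horner_prod normsqM normsq_prod -mulrA -exprMn.
rewrite lead_coefZ (monicP (monic_prod_XsubC _ _ _)) mulr1 ler_wpM2l ?normsq_ge0//.
have -> : (1 / 4 * x ^+ 2) ^+ size zs = \prod_(z <- zs) (1 / 4 * x ^+ 2).
  by rewrite big_const_seq iter_mulr_1 count_predT.
rewrite [leLHS]big_seq [leRHS]big_seq; apply: ler_prod => z zzs.
rewrite mulr_ge0 ?sqr_ge0//= hornerXsubC; apply: le_trans (sqr_Re_le _).
have -> : complex.Re (- 'i + (s * x)%:C - z) = s * x - complex.Re z.
  by case: (z) => a b /=; ring.
have : 2 * `|complex.Re z| <= x.
  apply: le_trans hx; rewrite ler_wpM2l// (big_rem z zzs) /= lerDl sumr_ge0//.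
have -> : (s * x - complex.Re z) ^+ 2 = (x - s * complex.Re z) ^+ 2.
  rewrite !sqrrB !exprMn s1; ring.
have h1 : s * complex.Re z <= `|complex.Re z|.
  have : `|s| = 1 by apply: (@pexpIrn R 2); rewrite ?nnegrE// real_normK ?num_real// expr1n.
  move=> hs; apply: le_trans (ler_norm _) _.
  by rewrite normrM hs mul1r.
by move=> h2; have := normr_ge0 (complex.Re z); nra.
Qed.

(** The domination of the [D m] by [f] is what rules out zero-free limits of
    exponential type, such as [exp (i u)], which is the limit of the
    polynomials [(1 + i u / n)^n]. *)
Lemma infinitely_many_zeros (E : nat -> {poly C}) (f : C -> C)
    (D : nat -> {poly C}) (K : R) :
  (forall n u, complex.Im u < 0 -> (E n).[u] != 0) ->
  (forall u, ccvg (fun n => (E n).[u]) (f u)) ->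
  (forall u, complex.Im u < 0 -> f u != 0) ->
  (forall m, (m < size (D m))%N) ->
  0 <= K ->
  (forall m (x : R), normsq (D m).[- 'i + x%:C] <=
    K * (1 + x ^+ 2) * normsq (f (- 'i + x%:C))) ->
  ([set u | f u = 0] #= [set: nat])%card.
Proof.
move=> hE Ef fL hD K0 hK; pose u0 : C := - 'i.
have lowNi : complex.Im u0 < 0 by rewrite /= oppr_lt0.
have /choice[T hT] : forall n, exists T : seq C,
    {in T, forall a : C, complex.Im a <= 0} /\
    forall t, (E n).[u0 + t] = (E n).[u0] * linprod T t.
  by move=> n; have [T h1 h2] := linprod_of_poly (hE n); exists T.
pose g t := f (u0 + t) / f u0.
have f0 : f u0 != 0 by exact: fL.
have T_lower n : {in T n, forall a : C, complex.Im a <= 0} by have [] := hT n.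
have T_cvg t : ccvg (fun n => linprod (T n) t) (g t).
  have e n : linprod (T n) t = (E n).[u0 + t] * (E n).[u0]^-1.
    by have [_ ->] := hT n; rewrite mulrAC mulfV ?mul1r// hE.
  by under eq_fun do rewrite e; apply: ccvgM => //; exact: ccvgV.
have low (x : R) : complex.Im (u0 + x%:C) < 0 by rewrite /= addr0 oppr_lt0.
have g1 : g 1 != 0 by rewrite mulf_neq0 ?invr_eq0//; apply: fL; exact: (low 1).
have gN1 : g (- 1) != 0.
  by rewrite mulf_neq0 ?invr_eq0//; apply: fL; have := low (-1); rewrite rmorphN1.
have gz u : f u = 0 -> g (u - u0) = 0 by move=> h; rewrite /g subrKC h mul0r.
apply: eq_card_nat.
  have -> : [set u | f u = 0] = \bigcup_(k : nat)
      [set u | f u = 0 /\ normsq (u - u0) <= k%:R].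
    apply/seteqP; split => [u fu|u [k _ []//]].
    exists (Num.trunc (normsq (u - u0))).+1 => //; split => //.
    by rewrite ltW // truncnS_gt.
  apply: bigcup_countable => // k _; apply: finite_set_countable.
  have := finite_zeros_in_disc T_lower T_cvg g1 gN1 k%:R.
  move/(finite_image (fun t => u0 + t)); apply: sub_finite_set.
  by move=> u [/= fu hu]; exists (u - u0); rewrite ?subrKC//; split => //; exact: gz.
move=> fin.
have [r r0 hr] : exists2 r : R, 0 < r & forall t, g t = 0 -> normsq t < r.
  have /finite_seqP[s hs] := fin.
  exists (1 + \sum_(u <- s) normsq (u - u0)).
    by rewrite ltr_pwDl// sumr_ge0// => u _; exact: normsq_ge0.
  move=> t gt; have : u0 + t \in s.
    have : [set` s] (u0 + t); last by [].
    rewrite -hs /=; apply/eqP; move/eqP: gt.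
    by rewrite mulf_eq0 invr_eq0 (negbTE f0) orbF.
  move=> ts; rewrite (big_rem _ ts) /= [u0 + t - u0]addrC addKr.
  have : 0 <= \sum_(y <- rem (u0 + t) s) normsq (y - u0).
    by rewrite sumr_ge0// => y _; exact: normsq_ge0.
  by move: (normsq t) (\sum_(_ <- _) _) => a b; lra.
have [s s1 [L [N hL]]] := poly_bound_of_finite_zeros T_lower T_cvg g1 gN1 r0 hr.
(* with this degree the left-hand side of the domination is of order
   [x ^ (2 N + 4)], against [x ^ (2 N + 2)] on the right *)
pose m := N.+2.
have Dm0 : D m != 0 by rewrite -size_poly_gt0 (leq_ltn_trans _ (hD m)).
have [c c0 [X hX]] := poly_lower_bound Dm0 s1.
have f00 : 0 < normsq (f u0) by rewrite normsq_gt0.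
pose A := 2 * K * `|L| * normsq (f u0) / c.
have A0 : 0 <= A by rewrite /A !mulr_ge0 ?invr_ge0 ?normr_ge0// ltW.
pose x := Num.max X (2 + A).
have x1 : 2 + A <= x by rewrite le_max lexx orbT.
have y1 : 1 <= x ^+ 2 by rewrite expr2; nra.
have := hX x; rewrite le_max lexx => /(_ isT); apply/negP; rewrite -ltNge.
apply: le_lt_trans (hK m _) _.
have sx2 : (s * x) ^+ 2 = x ^+ 2 by rewrite exprMn s1 mul1r.
have h1 : normsq (f (u0 + (s * x)%:C)) <= `|L| * (x ^+ 2) ^+ N * normsq (f u0).
  have xx : 1 <= x by lra.
  have := hL x xx; rewrite /g normsqM normsqV ler_pdivrMr// => h; apply: (le_trans h).
  by rewrite ler_wpM2r ?normsq_ge0// ler_wpM2r ?ler_norm// exprn_ge0// sqr_ge0.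
rewrite sx2; apply: (@le_lt_trans _ _ (c * A * (x ^+ 2) ^+ N.+1)).
  have -> : c * A * (x ^+ 2) ^+ N.+1 =
      K * (2 * x ^+ 2) * (`|L| * (x ^+ 2) ^+ N * normsq (f u0)).
    by rewrite /A exprS; field; rewrite gt_eqF.
  apply: ler_pM => //; rewrite ?normsq_ge0 ?mulr_ge0 ?addr_ge0 ?sqr_ge0//.
  by rewrite ler_wpM2l//; lra.
apply: (@lt_le_trans _ _ (c * (x ^+ 2) ^+ N.+2)).
  rewrite -mulrA ltr_pM2l// [ltRHS]exprS ltr_pM2r; last by rewrite exprn_gt0//; lra.
  by rewrite expr2; nra.
rewrite ler_pM2l// ler_weXn2l//; have := hD m.
by rewrite /m; case: (size (D m)).
Qed.

End ZerosOfPolynomialLimits.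

(** * Solutions of a three-term recurrence and their brackets *)

Section ComplexSeries.
Variable R : realType.
Local Notation C := R[i].

Lemma cauchy_schwarz_normsq (x y : nat -> C) n :
  normsq (\sum_(k < n) x k * y k) <=
  (\sum_(k < n) normsq (x k)) * (\sum_(k < n) normsq (y k)).
Proof.
elim: n => [|n ih]; first by rewrite !big_ord0 normsq0 mul0r.
rewrite !big_ord_recr /=.
have := normsqM (x n) (y n); have Y0 := normsq_ge0 (y n); have X0 := normsq_ge0 (x n).
have N0 : 0 <= \sum_(k < n) normsq (x k) by rewrite sumr_ge0// => k _; exact: normsq_ge0.
have M0 : 0 <= \sum_(k < n) normsq (y k) by rewrite sumr_ge0// => k _; exact: normsq_ge0.
set s := \sum_(k < n) x k * y k in ih *.
set N := (\sum_(k < n) normsq (x k)) in N0 ih *.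
set M := (\sum_(k < n) normsq (y k)) in M0 ih *.
move: (normsq (x n)) (normsq (y n)) X0 Y0 (x n * y n) => X Y X0 Y0 [t1 t2].
case: s ih => s1 s2; rewrite /normsq /= => ih.
move=> ht; pose t := s1 * t1 + s2 * t2.
have ht2 : t ^+ 2 <= (N * Y) * (M * X).
  apply: (@le_trans _ _ ((s1 ^+ 2 + s2 ^+ 2) * (t1 ^+ 2 + t2 ^+ 2))).
    by have := sqr_ge0 (s1 * t2 - s2 * t1); rewrite /t; nra.
  rewrite ht; have -> : N * Y * (M * X) = (N * M) * (X * Y) by ring.
  by rewrite ler_wpM2r // mulr_ge0.
have A0 : 0 <= N * Y by rewrite mulr_ge0.
have B0 : 0 <= M * X by rewrite mulr_ge0.
have : 2 * t <= N * Y + M * X.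
  rewrite leNgt; apply/negP => h.
  have AB : 0 <= N * Y + M * X by rewrite addr_ge0.
  have : (N * Y + M * X) * (N * Y + M * X) < (2 * t) * (2 * t) by apply: ltr_pM.
  have := sqr_ge0 (N * Y - M * X).
  by move: (N * Y) (M * X) ht2 => A B; lra.
by rewrite /t; lra.
Qed.

Lemma ccvg_cvg (u : nat -> C) (l : C) :
  ccvg u l -> (u : nat -> C^o) n @[n --> \oo] --> (l : C^o).
Proof.
move=> ul; apply/cvgrPdist_lt => e e0.
have := e0; rewrite ltcE /= => /andP[/eqP e2 e1].
have hl := ccvg_normsq (ccvgB ul (ccvg_cst l)).
rewrite subrr normsq0 in hl.
have he : 0 < complex.Re e ^+ 2 by rewrite exprn_gt0.
near=> n.
have h : normsq (u n - l) < complex.Re e ^+ 2 by near: n; exact: (cvgr_lt _ hl).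
rewrite distrC normc_def -/(normsq _) ltcE /= e2 eqxx /=.
have <- : Num.sqrt (complex.Re e ^+ 2) = complex.Re e.
  by rewrite sqrtr_sqr ger0_norm ?(ltW e1).
by rewrite ltr_sqrt.
Unshelve. all: by end_near. Qed.

Lemma bounded_sum_cvg (x : nat -> R) (M : R) :
  (forall k, 0 <= x k) -> (forall n, \sum_(k < n) x k <= M) ->
  cvgn (series x).
Proof.
move=> x0 hM; apply: nondecreasing_is_cvgn.
  by apply: nondecreasing_series => k _ _; exact: x0.
exists M => _ [n _ <-]; rewrite seriesEord; exact: hM.
Qed.

Lemma l2_product_ccvg (x y : nat -> C) (M N : R) :
  (forall n, \sum_(k < n) normsq (x k) <= M) ->
  (forall n, \sum_(k < n) normsq (y k) <= N) ->
  ccvg (fun n => \sum_(k < n) x k * y k) (cseries (fun k => x k * y k)).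
Proof.
move=> hM hN.
have sumle (h : nat -> R) :
    (forall k, `|h k| <= normsq (x k) + normsq (y k)) -> cvgn (series h).
  move=> hh; apply: normed_cvg.
  apply: (@bounded_sum_cvg _ (M + N)); first by move=> k; exact: normr_ge0.
  move=> n.
  apply: le_trans (lerD (hM n) (hN n)); rewrite -big_split /=.
  by apply: ler_sum => k _; exact: hh.
have le1 (u v : C) : `|complex.Re (u * v)| <= normsq u + normsq v.
  case: u v => a b [c d]; rewrite /normsq /= ler_norml.
  have := sqr_ge0 (a - c); have := sqr_ge0 (a + c).
  have := sqr_ge0 (b - d); have := sqr_ge0 (b + d) => *.
  by apply/andP; split; nra.
have h1 : cvgn (series (fun k => complex.Re (x k * y k))) by apply: sumle => k.
have h2 : cvgn (series (fun k => complex.Im (x k * y k))).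
  apply: sumle => k.
  have -> : complex.Im (x k * y k) = complex.Re ((- 'i * x k) * y k).
    by case: (x k) (y k) => a b [c d] /=; ring.
  apply: (le_trans (le1 _ _)); rewrite normsqM.
  have -> : normsq (- 'i : C) = 1 by rewrite /normsq /=; ring.
  by rewrite mul1r.
pose l := limn (series (fun k => complex.Re (x k * y k))) +i*
  limn (series (fun k => complex.Im (x k * y k))).
have hc : ccvg (fun n => \sum_(k < n) x k * y k) l.
  split => /=.
    by under eq_fun do rewrite Re_sum -(big_mkord xpredT (fun k => complex.Re (x k * y k))).
  by under eq_fun do rewrite Im_sum -(big_mkord xpredT (fun k => complex.Im (x k * y k))).
suff -> : cseries (fun k => x k * y k) = l by [].
have h : (series (fun k => x k * y k) : nat -> C^o) n @[n --> \oo] --> (l : C^o).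
  by have := ccvg_cvg hc; under eq_fun do rewrite -(big_mkord xpredT (fun k => x k * y k)).
exact: (cvg_lim (@norm_hausdorff _ _) h).
Qed.

Lemma ceval_conj (P : {poly R}) (z : C) : ceval P z^* = (ceval P z)^*.
Proof.
rewrite /ceval -[RHS]horner_map /= -map_poly_comp.
by congr horner; apply: eq_map_poly => c; rewrite /= oppr0.
Qed.

End ComplexSeries.

Section Nevanlinna.
Variable R : realType.
Local Notation C := R[i].
Variables (p q : nat -> {poly R}) (a b : nat -> R).

Definition jacobi (z : C) (y : nat -> C) : Prop := forall n,
  (b n.+1)%:C * y n.+2 = (z - (a n.+1)%:C) * y n.+1 - (b n)%:C * y n.

(** The factor [b n] makes the bracket of two solutions with the same parameter
    independent of [n], as for a Wronskian. *)
Definition bracket n (x y : nat -> C) : C :=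
  (b n)%:C * (x n.+1 * y n - x n * y n.+1).

Lemma plucker n (x x' y y' : nat -> C) :
  bracket n x y * bracket n x' y' - bracket n x y' * bracket n x' y =
  bracket n x x' * bracket n y y'.
Proof. by rewrite /bracket; ring. Qed.

Lemma bracketS n u v x y : jacobi u x -> jacobi v y ->
  bracket n.+1 x y = bracket n x y + (u - v) * (x n.+1 * y n.+1).
Proof.
move=> hx hy; rewrite /bracket mulrBr !mulrA hx -[_ * x n.+1 * y n.+2]mulrA.
rewrite [x n.+1 * _]mulrC mulrA hy; ring.
Qed.

Lemma bracket_conj n (x y : nat -> C) :
  bracket n (fun k => (x k)^*) (fun k => (y k)^*) = (bracket n x y)^*.
Proof. by rewrite /bracket rmorphM rmorphB !rmorphM /= oppr0. Qed.

(** [true] stands for the first kind and [false] for the second kind, so that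
    [~~ t] is the kind of the complementary solution. *)
Definition sol (t : bool) (u : C) k : C := ceval (if t then p k else q k) u.

Hypothesis sol_jacobi : forall t u, jacobi u (sol t u).
Hypothesis p0 : p 0%N = 1.
Hypothesis q0 : q 0%N = 0.
Hypothesis p1 : forall u, (b 0)%:C * ceval (p 1) u = u - (a 0)%:C.
Hypothesis q1 : forall u, (b 0)%:C * ceval (q 1) u = 1.
Hypothesis size_p : forall n, (n < size (p n))%N.
Hypothesis size_q : forall n, (n < size (q n.+1))%N.
Hypothesis sol_l2 : forall t u, exists M : R, forall n,
  \sum_(k < n) normsq (sol t u k) <= M.

(** The constant terms [-1] and [1] of B and C, and [0] for A and D. *)
Definition jump (t t' : bool) : R := t'%:R - t%:R.

Definition nevF (t t' : bool) (u v : C) : C :=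
  (jump t t')%:C + (u - v) * cseries (fun k => sol t u k * sol t' v k).

Lemma bracket_sol n t t' u v : bracket n (sol t u) (sol t' v) =
  (jump t t')%:C + (u - v) * \sum_(k < n.+1) sol t u k * sol t' v k.
Proof.
have c1 : ceval (1 : {poly R}) = (fun=> 1).
  by apply/funext => z; rewrite /ceval rmorph1 hornerC.
have c0 : ceval (0 : {poly R}) = (fun=> 0).
  by apply/funext => z; rewrite /ceval rmorph0 horner0.
elim: n => [|n ih]; last first.
  rewrite (bracketS n (sol_jacobi t u) (sol_jacobi t' v)) ih.
  by rewrite [in RHS]big_ord_recr /= mulrDr addrA.
rewrite big_ord_recr big_ord0 /= add0r /bracket /sol /jump mulrBr.
rewrite !mulrA [_ * _ * ceval (if t' then p 1%N else q 1%N) v]mulrAC.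
case: t t' => [] [] /=; rewrite ?p0 ?q0 ?c1 ?c0 ?p1 ?q1 /=;
 apply/eqP; rewrite eq_complex; case: u v => ? ? [? ?] /=; apply/andP; split; apply/eqP; ring.
Qed.

Lemma sol_conj t u k : sol t u^* k = (sol t u k)^*.
Proof. exact: ceval_conj. Qed.

(** The index starts at [1] because the solution of the second kind vanishes at
    [0]: from then on all the sums of squares are positive. *)
Lemma nevF_ccvg t t' u v :
  ccvg (fun n => bracket n.+1 (sol t u) (sol t' v)) (nevF t t' u v).
Proof.
under eq_fun do rewrite bracket_sol.
apply: ccvgD; first exact: ccvg_cst.
apply: ccvgM; first exact: ccvg_cst.
have [M hM] := sol_l2 t u; have [N hN] := sol_l2 t' v.
have [h1 h2] := l2_product_ccvg hM hN.
by split; [rewrite -(cvg_shiftn 2) in h1|rewrite -(cvg_shiftn 2) in h2]; under eq_fun do rewrite -addn2.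
Qed.

Lemma nevF_conj t t' u v : nevF t t' u^* v^* = (nevF t t' u v)^*.
Proof.
apply: (ccvg_unique (nevF_ccvg t t' u^* v^*)).
have := ccvgJ (nevF_ccvg t t' u v).
congr (ccvg _ _); apply/funext => n; rewrite -bracket_conj.
by congr bracket; apply/funext => k; rewrite sol_conj.
Qed.

Definition energy t u n : R := \sum_(k < n) normsq (sol t u k).

Lemma energy_ge0 t u n : 0 <= energy t u n.
Proof. by rewrite sumr_ge0// => k _; exact: normsq_ge0. Qed.

Lemma le_energy t u m n : (m <= n)%N -> energy t u m <= energy t u n.
Proof.
move=> mn; rewrite /energy -!(big_mkord xpredT (fun k => normsq (sol t u k))).
rewrite [leRHS](big_cat_nat (leq0n m) mn) /= lerDl sumr_ge0// => k _; exact: normsq_ge0.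
Qed.

Lemma normsq_sol_le t u k n : (k < n)%N -> normsq (sol t u k) <= energy t u n.
Proof.
move=> kn; rewrite /energy (bigD1 (Ordinal kn)) //= lerDl sumr_ge0// => j _.
exact: normsq_ge0.
Qed.

Lemma energy_conj t u n : energy t u^* n = energy t u n.
Proof. by apply: eq_bigr => k _; rewrite sol_conj normsqJ. Qed.

Lemma energy2_gt0 t u : 0 < energy t u 2.
Proof.
rewrite /energy !big_ord_recr big_ord0 /= add0r /sol.
case: t; rewrite ?p0 ?q0 /ceval.
  by rewrite rmorph1 hornerC normsq1 ltr_pwDl// normsq_ge0.
rewrite rmorph0 horner0 normsq0 add0r normsq_gt0.
have := q1 u; rewrite /ceval => /eqP; apply: contraTneq => ->.
by rewrite mulr0 eq_sym oner_eq0.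
Qed.

Lemma bracket_sol_conj n t u :
  bracket n (sol t u) (sol t u^*) = (2 * complex.Im u * energy t u n.+1)%:C * 'i.
Proof.
rewrite bracket_sol /jump subrr.
have -> : \sum_(k < n.+1) sol t u k * sol t u^* k = (energy t u n.+1)%:C.
  rewrite /energy rmorph_sum; apply: eq_bigr => k _.
  by rewrite sol_conj mulJ_normsq.
by rewrite subcJ; apply/eqP; rewrite eq_complex /=; apply/andP; split; apply/eqP; ring.
Qed.

Lemma normsq_bracket_sol n t v :
  normsq (bracket n (sol t v) (sol (~~ t) v)) = 1.
Proof.
rewrite bracket_sol subrr mul0r addr0 /jump normsq_real.
by case: t; rewrite ?subr0 ?sub0r ?sqrrN expr1n.
Qed.

(** Pluecker relation for the solutions at [u], its conjugate, [v] and its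
    conjugate; the brackets of conjugate pairs are, up to an imaginary
    factor, sums of squares. *)
Lemma normsq_bracket_sub n t t' u v :
  normsq (bracket n (sol t u) (sol t' v)) -
  normsq (bracket n (sol t u^*) (sol t' v)) =
  - 4 * complex.Im u * complex.Im v * energy t u n.+1 * energy t' v n.+1.
Proof.
have cj w : bracket n (sol t w) (sol t' v^*) = (bracket n (sol t w^*) (sol t' v))^*.
  rewrite -bracket_conj; congr bracket; apply/funext => k; rewrite -sol_conj ?conjcK//.
have := plucker n (sol t u) (sol t u^*) (sol t' v) (sol t' v^*).
rewrite !cj conjcK !bracket_sol_conj.
set x := bracket _ _ _; set y := bracket _ _ _.
rewrite mulJ_normsq [y^* * _]mulrC mulJ_normsq => /(congr1 (@complex.Re R)) /=.
move=> ->; ring.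
Qed.

(** Pluecker relation in which the complementary solutions at [v] have a bracket
    of modulus [1], while the bracket of the solutions at [u] and [w] is the
    Christoffel-Darboux kernel. *)
Lemma bracket_cross n t t' u w v :
  normsq (u - w) * normsq (\sum_(k < n.+1) sol t u k * sol t w k) =
  normsq (bracket n (sol t u) (sol t' v) * bracket n (sol t w) (sol (~~ t') v) -
          bracket n (sol t u) (sol (~~ t') v) * bracket n (sol t w) (sol t' v)).
Proof.
rewrite plucker [bracket n (sol t u) (sol t w)]bracket_sol /jump subrr add0r.
by rewrite [RHS]normsqM normsq_bracket_sol mulr1 normsqM.
Qed.

Section UpperHalfPlane.
Variables (t t' : bool) (v : C).
Hypothesis v_ge0 : 0 <= complex.Im v.

Let E n u := bracket n (sol t u) (sol t' v).
Let E' n u := bracket n (sol t u) (sol (~~ t') v).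

Lemma normsq_bracket_le n u : complex.Im u < 0 ->
  normsq (E n u^*) <= normsq (E n u).
Proof.
move=> u0; rewrite -subr_ge0 normsq_bracket_sub.
have -> : - 4 * complex.Im u * complex.Im v * energy t u n.+1 * energy t' v n.+1
  = 4 * ((- complex.Im u) * complex.Im v * energy t u n.+1 * energy t' v n.+1) by ring.
by rewrite !mulr_ge0 ?energy_ge0// oppr_ge0 ltW.
Qed.

(** This is [bracket_cross] for [u] and its conjugate, whose bracket is the
    smaller one by [normsq_bracket_le]. *)
Lemma energy_le_bracket n u : complex.Im u < 0 ->
  2 * complex.Im u ^+ 2 * energy t u n.+1 ^+ 2 <=
  normsq (E n u) * (normsq (E' n u) + normsq (E' n u^*)).
Proof.
move=> u0; have := bracket_cross n t t' u u^* v.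
have -> : \sum_(k < n.+1) sol t u k * sol t u^* k = (energy t u n.+1)%:C.
  rewrite /energy rmorph_sum; apply: eq_bigr => k _.
  by rewrite sol_conj mulJ_normsq.
rewrite -/(E n u) -/(E' n u) -/(E n u^*) -/(E' n u^*).
have := normsq_bracket_le n u0.
move: (E n u) (E n u^*) (E' n u) (E' n u^*) => x xc y yc h1.
rewrite normsq_real subcJ !normsqM normsq_real.
have -> : normsq ('i : C) = 1 by rewrite /normsq /=; ring.
have -> : normsq (2 : C) = 4 by rewrite /normsq /=; ring.
rewrite mulr1 => h2.
have h3 := normsq_le2 (x * yc) (- (y * xc)); rewrite normsqN !normsqM in h3.
have : normsq y * normsq xc <= normsq x * normsq y.
  by rewrite [leRHS]mulrC ler_wpM2l ?normsq_ge0.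
by move: h3; rewrite -h2; lra.
Qed.

Lemma bracket_neq0 n u : complex.Im u < 0 -> E n.+1 u != 0.
Proof.
move=> u0; have := energy_le_bracket n.+1 u0; apply: contraTneq => ->.
rewrite normsq0 mul0r -ltNge.
have i2 : 0 < complex.Im u ^+ 2 by rewrite lt_def sqr_ge0 andbT sqrf_eq0 lt_eqF.
have e2 : 0 < energy t u n.+2 by apply: lt_le_trans (energy2_gt0 t u) _; exact: le_energy.
by apply: mulr_gt0; [apply: mulr_gt0 | rewrite exprn_gt0].
Qed.

Lemma energy_le_limit m u : complex.Im u < 0 ->
  2 * complex.Im u ^+ 2 * energy t u m ^+ 2 <=
  normsq (nevF t t' u v) *
  (normsq (nevF t (~~ t') u v) + normsq (nevF t (~~ t') u^* v)).
Proof.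
move=> u0; have h1 := ccvg_normsq (nevF_ccvg t t' u v).
have h2 := ccvg_normsq (nevF_ccvg t (~~ t') u v).
have h3 := ccvg_normsq (nevF_ccvg t (~~ t') u^* v).
have hc : normsq (E n.+1 u) * (normsq (E' n.+1 u) + normsq (E' n.+1 u^*)) @[n --> \oo]
    --> normsq (nevF t t' u v) *
      (normsq (nevF t (~~ t') u v) + normsq (nevF t (~~ t') u^* v)).
  by apply: (@cvgM R) => //; exact: cvgD.
apply: (cvgr_to_ge hc); near=> n => /=.
apply: le_trans (energy_le_bracket n.+1 u0).
apply: ler_wpM2l; first by rewrite mulr_ge0// sqr_ge0.
rewrite ler_sqr ?nnegrE ?energy_ge0//; apply: le_energy.
by near: n; exists m => // n /= mn; rewrite (leq_trans mn)// -addn2 leq_addr.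
Unshelve. all: by end_near. Qed.

Lemma nevF_neq0 u : complex.Im u < 0 -> nevF t t' u v != 0.
Proof.
move=> u0; have := energy_le_limit 2 u0; apply: contraTneq => ->.
rewrite normsq0 mul0r -ltNge.
have i2 : 0 < complex.Im u ^+ 2 by rewrite lt_def sqr_ge0 andbT sqrf_eq0 lt_eqF.
by apply: mulr_gt0; [apply: mulr_gt0 | rewrite exprn_gt0// energy2_gt0].
Qed.

(** Controls the complementary bracket at [u] by its value at a base point [w],
    as Pick's inequality does for the quotient of two brackets. *)
Lemma bracket_compl_le n u w (M : R) : energy t w n.+1 <= M ->
  normsq (E' n u) * normsq (E n w) <=
  2 * (normsq (E n u) * normsq (E' n w)) + 2 * (normsq (u - w) * (energy t u n.+1 * M)).
Proof.
move=> hM; have := bracket_cross n t t' u w v.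
rewrite -/(E n u) -/(E' n u) -/(E n w) -/(E' n w).
have hS : normsq (u - w) * normsq (\sum_(k < n.+1) sol t u k * sol t w k) <=
    normsq (u - w) * (energy t u n.+1 * M).
  rewrite ler_wpM2l ?normsq_ge0//; apply: le_trans (cauchy_schwarz_normsq _ _ _) _.
  by rewrite ler_wpM2l// energy_ge0.
move: (E n u) (E' n u) (E n w) (E' n w) => x y z c h.
rewrite h in hS.
have := normsq_le2 (x * c) (- (x * c - y * z)).
have -> : x * c - (x * c - y * z) = y * z by ring.
by rewrite normsqN -!normsqM; lra.
Qed.

(** On the line [Im u = -1] the sum of squares is bounded through
    [energy_le_bracket] by the bracket times the complementary one, which is
    compared with the base point [- 'i] by [bracket_compl_le]. *)
Lemma energy_growth : exists2 K : R, 0 <= K & forall m (x : R),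
  energy t (- 'i + x%:C) m <=
  K * (1 + x ^+ 2) * normsq (nevF t t' (- 'i + x%:C) v).
Proof.
pose w : C := - 'i; have w0 : complex.Im w < 0 by rewrite /= oppr_lt0.
have [M hM] := sol_l2 t w.
have M0 : 0 <= M by have := hM 0%N; rewrite big_ord0.
pose ew := normsq (nevF t t' w v); pose ew' := normsq (nevF t (~~ t') w v).
have ew0 : 0 < ew by rewrite normsq_gt0 nevF_neq0.
have ew'0 : 0 <= ew' by exact: normsq_ge0.
exists ((2 * ew' + ew + 4 * M) / ew).
  by apply: divr_ge0; [lra | exact: ltW].
move=> m x; set u := w + x%:C.
have u1 : complex.Im u = -1 by rewrite /= addr0.
have u0 : complex.Im u < 0 by rewrite u1 oppr_lt0.
pose d := 2 * x ^+ 2 + 4.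
have x20 : 0 <= x ^+ 2 by exact: sqr_ge0.
have key n : (m <= n.+2)%N -> energy t u m * normsq (E n.+1 w) <=
    normsq (E n.+1 u) * (2 * normsq (E' n.+1 w) + normsq (E n.+1 w) + d * M).
  move=> mn; have h1 := bracket_compl_le u (hM n.+2).
  have hMc : energy t w n.+2 <= M by exact: hM.
  have h2 := bracket_compl_le u^* hMc.
  have h3 := normsq_bracket_le n.+1 u0.
  have h4 := energy_le_bracket n.+1 u0.
  rewrite energy_conj in h2.
  have h5 : energy t u m <= energy t u n.+2 by apply: le_energy.
  have N0 := energy_ge0 t u n.+2.
  have d1 : normsq (u - w) = x ^+ 2 by rewrite /u [w + _]addrC addrK normsq_real.
  have d2 : normsq (u^* - w) = x ^+ 2 + 4 by rewrite /normsq /u /w /=; ring.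
  rewrite d1 in h1; rewrite d2 in h2; rewrite u1 sqrrN expr1n mulr1 in h4.
  have e0 := normsq_ge0 (E n.+1 u).
  have z0 := normsq_ge0 (E n.+1 w); have z'0 := normsq_ge0 (E' n.+1 w).
  move: h1 h2 h3 h4 e0 z0 z'0.
  move: (normsq (E n.+1 u)) (normsq (E n.+1 u^*)) (normsq (E' n.+1 u)) (normsq (E' n.+1 u^*)).
  move: (normsq (E n.+1 w)) (normsq (E' n.+1 w)) => z z' e ec f fc h1 h2 h3 h4 e0 z0 z'0.
  apply: (@le_trans _ _ (energy t u n.+2 * z)); first by rewrite ler_wpM2r.
  move: (energy t u n.+2) N0 h1 h2 h4 => N N0 h1 h2 h4 {h5 mn d1 d2}.
  have d0 : 0 <= d by rewrite /d; lra.
  have dM0 : 0 <= d * M by rewrite mulr_ge0.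
  (* if [N] exceeds [e], the quadratic inequality [g1] can be divided by [N] *)
  have [eN|Ne] := leP N e.
    apply: (@le_trans _ _ (e * z)); first by rewrite ler_wpM2r.
    by rewrite ler_wpM2l//; lra.
  have Npos : 0 < N by lra.
  rewrite -(ler_pM2l Npos).
  have g1 : 2 * (N * (N * z)) <= e * (f * z + fc * z).
    have := ler_wpM2r z0 h4; rewrite expr2; lra.
  have g2 : f * z + fc * z <= 4 * (e * z') + 2 * (d * (N * M)).
    have : ec * z' <= e * z' by rewrite ler_wpM2r.
    by rewrite /d; lra.
  have g3 := ler_wpM2l e0 g2.
  have g4 : e * (e * z') <= N * (e * z') by rewrite ler_wpM2r ?mulr_ge0// ltW.
  have g5 : 0 <= N * (e * z) by rewrite !mulr_ge0.
  by move: g1 g3 g4 g5; rewrite /d; nra.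
have h1 := ccvg_normsq (nevF_ccvg t t' u v).
have h2 := ccvg_normsq (nevF_ccvg t t' w v).
have h3 := ccvg_normsq (nevF_ccvg t (~~ t') w v).
have hl : energy t u m * ew <= normsq (nevF t t' u v) * (2 * ew' + ew + d * M).
  have l1 : energy t u m * normsq (E n.+1 w) @[n --> \oo] --> energy t u m * ew.
    by apply: (@cvgM R) => //; exact: cvg_cst.
  have l2 : normsq (E n.+1 u) * (2 * normsq (E' n.+1 w) + normsq (E n.+1 w) + d * M)
      @[n --> \oo] --> normsq (nevF t t' u v) * (2 * ew' + ew + d * M).
    apply: (@cvgM R) => //; apply: cvgD; last exact: cvg_cst.
    by apply: cvgD => //; apply: (@cvgM R) => //; exact: cvg_cst.
  apply: (ler_cvg_to l1 l2); near=> n; apply: key.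
  by near: n; exists m => // n /= mn; rewrite (leq_trans mn)// -addn2 leq_addr.
move: hl; rewrite -ler_pdivlMr// => hl; apply: (le_trans hl).
have -> : normsq (nevF t t' u v) * (2 * ew' + ew + d * M) / ew =
    (2 * ew' + ew + d * M) / ew * normsq (nevF t t' u v).
  by rewrite -mulrA [LHS]mulrC.
apply: ler_wpM2r; first exact: normsq_ge0.
rewrite mulrAC; apply: ler_wpM2r; first by rewrite invr_ge0 ltW.
have : 0 <= M * x ^+ 2 by rewrite mulr_ge0.
have : 0 <= ew' * x ^+ 2 by rewrite mulr_ge0.
have : 0 <= ew * x ^+ 2 by rewrite mulr_ge0// ltW.
by rewrite /d; nra.
Unshelve. all: by end_near. Qed.

Lemma nevF_zeros_card : ([set u | nevF t t' u v = 0] #= [set: nat])%card.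
Proof.
have [K K0 hK] := energy_growth.
have bE n : exists P : {poly C}, forall u, P.[u] = E n.+1 u.
  pose X k := map_poly (real_complex R) (if t then p k else q k).
  exists ((b n.+1)%:C *: (X n.+2 * (sol t' v n.+1)%:P - X n.+1 * (sol t' v n.+2)%:P)).
  by move=> u; rewrite hornerZ hornerD hornerN !hornerM !hornerC.
have /choice[P hP] := bE.
pose D m := map_poly (real_complex R) (if t then p m else q m.+1).
apply: (@infinitely_many_zeros _ P _ D K) => //.
- by move=> n u u0; rewrite hP bracket_neq0.
- by move=> u; under eq_fun do rewrite hP; exact: nevF_ccvg.
- exact: nevF_neq0.
- by move=> m; rewrite /D size_map_poly; case: t.
- move=> m x; apply: le_trans (hK m.+2 x).
  rewrite /D; case: (t) => /=; first exact: (@normsq_sol_le true).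
  exact: (@normsq_sol_le false).
Qed.

Lemma nevF_zero_ge0 u : nevF t t' u v = 0 -> 0 <= complex.Im u.
Proof.
by move=> h; rewrite leNgt; apply/negP => /nevF_neq0; rewrite h eqxx.
Qed.

End UpperHalfPlane.

(** For real [u] a zero at [(u, v)] is also a zero at [(u, conj v)]. The
    Pluecker relation with the complementary solution at [u] would then
    force the bracket of the solutions at [v] and [conj v] to tend to [0],
    although it is, up to a nonzero constant, a nondecreasing sum of
    squares. *)
Lemma nevF_real_neq0 t t' u v : complex.Im u = 0 -> complex.Im v != 0 ->
  nevF t t' u v != 0.
Proof.
move=> u0 v0; apply/eqP => h.
have uJ : u^* = u by case: u u0 {h} => x y /= ->; rewrite oppr0.
have h' : nevF t t' u v^* = 0 by rewrite -uJ nevF_conj h conjc0.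
have lim := ccvgB
  (ccvgM (nevF_ccvg t t' u v) (nevF_ccvg (~~ t) t' u v^*))
  (ccvgM (nevF_ccvg t t' u v^*) (nevF_ccvg (~~ t) t' u v)).
rewrite h h' !mul0r subrr in lim.
have := ccvg_normsq lim; rewrite normsq0.
have e0 := energy2_gt0 t' v.
have i2 : 0 < complex.Im v ^+ 2 by rewrite lt_def sqr_ge0 andbT sqrf_eq0.
move/cvgr_lt => /(_ (4 * complex.Im v ^+ 2 * energy t' v 2 ^+ 2)) [].
  by apply: mulr_gt0; [apply: mulr_gt0 | rewrite exprn_gt0].
move=> n _ /(_ n (leqnn n)) /=; apply/negP; rewrite -leNgt.
rewrite plucker.
rewrite normsqM normsq_bracket_sol mul1r bracket_sol_conj normsqM normsq_real.
have -> : normsq ('i : C) = 1 by rewrite /normsq /=; ring.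
rewrite mulr1 !exprMn -natrX; apply: ler_wpM2l; first by rewrite mulr_ge0// ltW.
by rewrite ler_sqr ?nnegrE ?energy_ge0// le_energy.
Qed.

Theorem nevF_zeros t t' v :
  [/\ ([set u | nevF t t' u v = 0] #= [set: nat])%card,
      (complex.Im v = 0 -> [set u | nevF t t' u v = 0] `<=` [set u | complex.Im u = 0]),
      (0 < complex.Im v -> [set u | nevF t t' u v = 0] `<=` [set u | 0 < complex.Im u]) &
      (complex.Im v < 0 -> [set u | nevF t t' u v = 0] `<=` [set u | complex.Im u < 0])].
Proof.
have refl u w : nevF t t' u w = 0 -> nevF t t' u^* w^* = 0.
  by rewrite nevF_conj => ->; rewrite conjc0.
have lower w u : complex.Im w <= 0 -> nevF t t' u w = 0 -> complex.Im u <= 0.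
  move=> w0 /refl /nevF_zero_ge0; rewrite !ImJ !oppr_ge0; exact.
split.
- have [v0|v0] := leP 0 (complex.Im v); first exact: nevF_zeros_card.
  have vJ0 : 0 <= complex.Im v^* by rewrite ImJ oppr_ge0 ltW.
  apply: card_eq_trans (nevF_zeros_card t t' vJ0).
  have -> : [set u | nevF t t' u v = 0] = (@conjc R) @` [set u | nevF t t' u v^* = 0].
    apply/seteqP; split => [u /= hu|_ [u /= hu <-]].
      by exists u^*; rewrite ?conjcK//; exact: refl.
    by rewrite -[v]conjcK; exact: refl.
  apply: inj_card_eq => x y _ _; exact: (can_inj (@conjcK R)).
- move=> v0 u /= hu; apply/eqP; rewrite eq_le (lower v)// ?v0//=.
  by rewrite (@nevF_zero_ge0 t t' v)// v0.
- move=> v0 u /= hu; rewrite lt_def (@nevF_zero_ge0 t t' v) ?(ltW v0)// andbT.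
  by apply/eqP => u0; have := nevF_real_neq0 t t' u0 (lt0r_neq0 v0); rewrite hu eqxx.
- move=> v0 u /= hu; rewrite lt_neqAle (lower v) ?(ltW v0)// andbT.
  apply/eqP => u0; have := nevF_real_neq0 t t' u0 (ltr0_neq0 v0); rewrite hu eqxx //.
Qed.

End Nevanlinna.

(** * Moment functional, orthonormal polynomials, polynomials of the second kind *)

Section PolynomialExtension.
Variables (R : realType) (V : lmodType R) (w : nat -> V).
Implicit Types f g : {poly R}.

(** The linear map sending ['X^k] to [w k]: real and polynomial values of [w]
    give the moment functional and the polynomials of the second kind. *)
Definition pext f : V := \sum_(k < size f) f`_k *: w k.

Lemma pextE n f : (size f <= n)%N -> pext f = \sum_(k < n) f`_k *: w k.
Proof.
move=> fn; rewrite /pext (big_ord_widen _ (fun k => f`_k *: w k) fn).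
rewrite big_mkcond; apply: eq_bigr => k _; case: ltnP => // /(nth_default 0) ->.
by rewrite scale0r.
Qed.

Lemma pextD f g : pext (f + g) = pext f + pext g.
Proof.
pose n := maxn (size f) (size g).
rewrite (@pextE n f) ?leq_maxl// (@pextE n g) ?leq_maxr// (@pextE n) ?size_polyD//.
by rewrite -big_split; apply: eq_bigr => k _; rewrite coefD scalerDl.
Qed.

Lemma pextZ (c : R) f : pext (c *: f) = c *: pext f.
Proof.
rewrite (@pextE (size f) (c *: f)) ?size_scale_leq// /pext scaler_sumr.
by apply: eq_bigr => k _; rewrite coefZ scalerA.
Qed.

Lemma pextC (c : R) : pext c%:P = c *: w 0.
Proof.
by rewrite (@pextE 1) ?size_polyC_leq1// big_ord1 coefC.
Qed.

Lemma pext0 : pext 0 = 0.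
Proof. by rewrite -[0](scale0r 0) pextZ scale0r. Qed.

Lemma pext_sum (I : Type) (r : seq I) (P : pred I) (F : I -> {poly R}) :
  pext (\sum_(i <- r | P i) F i) = \sum_(i <- r | P i) pext (F i).
Proof. exact: (big_morph _ pextD pext0). Qed.

End PolynomialExtension.

Lemma pextMX (R : realType) (V : lmodType R) (w : nat -> V) (f : {poly R}) :
  pext w (f * 'X) = pext (fun k => w k.+1) f.
Proof.
rewrite (@pextE _ _ _ (size f).+1); last first.
  by have [->|f0] := eqVneq f 0; rewrite ?mul0r ?size_poly0// size_mulX.
rewrite big_ord_recl coefMX eqxx scale0r add0r.
by apply: eq_bigr => k _; rewrite coefMX.
Qed.

Section Moments.
Variables (R : realType) (s : nat -> R).
Local Notation C := R[i].
Implicit Types f g : {poly R}.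

Definition moment_fun f : R := pext (s : nat -> R^o) f.
Local Notation L := moment_fun.

Fixpoint second_monomial k : {poly R} :=
  if k is k'.+1 then second_monomial k' * 'X + (s k')%:P else 0.

(** The polynomial [z |-> L ((f(z) - f(x)) / (z - x))], where [L] is the moment
    functional acting on the variable [x]. *)
Definition second_poly f : {poly R} := pext second_monomial f.
Local Notation T := second_poly.

Lemma moment_funD f g : L (f + g) = L f + L g.
Proof. exact: pextD. Qed.

Lemma moment_funZ c f : L (c *: f) = c * L f.
Proof. exact: pextZ. Qed.

Lemma moment_fun_sum (I : Type) (r : seq I) (P : pred I) (F : I -> {poly R}) :
  L (\sum_(i <- r | P i) F i) = \sum_(i <- r | P i) L (F i).
Proof. exact: pext_sum. Qed.

Lemma second_polyMX f : T (f * 'X) = T f * 'X + (L f)%:P.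
Proof.
rewrite /T pextMX /moment_fun /pext mulr_suml rmorph_sum -big_split.
by apply: eq_bigr => k _ /=; rewrite scalerDr scalerAl polyCM mul_polyC.
Qed.

Lemma second_polyC c : T c%:P = 0.
Proof. by rewrite /T pextC scaler0. Qed.

Lemma cevalD f g (z : C) : ceval (f + g) z = ceval f z + ceval g z.
Proof. by rewrite /ceval rmorphD hornerD. Qed.

Lemma cevalM f g (z : C) : ceval (f * g) z = ceval f z * ceval g z.
Proof. by rewrite /ceval rmorphM hornerM. Qed.

Lemma cevalX (z : C) : ceval ('X : {poly R}) z = z.
Proof. by rewrite /ceval map_polyX hornerX. Qed.

Lemma cevalC c (z : C) : ceval (c%:P : {poly R}) z = c%:C.
Proof. by rewrite /ceval map_polyC hornerC. Qed.

Lemma ceval_real f (x : R) : ceval f x%:C = f.[x]%:C.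
Proof. by rewrite /ceval horner_map. Qed.

Lemma divided_differenceMXD f c (z : C) (x : R) :
  divided_difference (f * 'X + c%:P) z x = z * divided_difference f z x + f.[x]%:C.
Proof.
rewrite /divided_difference; case: eqP => [->|/eqP zx].
  rewrite derivD derivM derivX derivC addr0 mulr1 cevalD cevalM cevalX.
  by rewrite mulrC (ceval_real f).
rewrite !cevalD !cevalM !cevalX !cevalC (ceval_real f).
by field; rewrite subr_eq0.
Qed.

(** For fixed [z] the divided difference is a polynomial in [x] with complex
    coefficients; treating its real and imaginary parts separately allows
    real moment functionals and integrals to be applied. *)
Lemma divided_difference_parts f (z : C) : exists A B : {poly R},
  (forall x, divided_difference f z x = A.[x] +i* B.[x]) /\
  ceval (T f) z = L A +i* L B.
Proof.
elim/poly_ind: f => [|f c [A [B [h1 h2]]]].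
  exists 0, 0; split; last by rewrite /T /moment_fun !pext0 /ceval rmorph0 horner0.
  by move=> x; rewrite /divided_difference deriv0 /ceval rmorph0 !horner0 subrr mul0r if_same.
exists (complex.Re z *: A - complex.Im z *: B + f),
  (complex.Re z *: B + complex.Im z *: A); split.
  move=> x; rewrite divided_differenceMXD h1 !(hornerD, hornerN, hornerZ).
  by case: (z) => a b; apply/eqP; rewrite eq_complex /= addr0; apply/andP; split; apply/eqP; ring.
have -> : T (f * 'X + c%:P) = T f * 'X + (L f)%:P.
  by rewrite /T pextD -/(T _) -/(T _) second_polyMX second_polyC addr0.
rewrite cevalD cevalM cevalX cevalC h2.
rewrite !moment_funD -scaleNr !moment_funZ.
by case: (z) => a b; apply/eqP; rewrite eq_complex /= addr0; apply/andP; split; apply/eqP; ring.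
Qed.

Section Orthonormal.
Variable p : nat -> {poly R}.
Hypothesis p0 : p 0%N = 1.
Hypothesis size_p : forall n, size (p n) = n.+1.
Hypothesis p_orth : forall n m, L (p n * p m) = (n == m)%:R.

Lemma orth_expansion n f : (size f <= n)%N ->
  f = \sum_(k < n) L (f * p k) *: p k.
Proof.
move=> fn; have [c fc] : exists c : nat -> R, f = \sum_(k < n) c k *: p k.
  elim: n f fn => [|n ih] f fn.
    by exists (fun=> 0); rewrite big_ord0; apply/eqP; rewrite -size_poly_leq0.
  pose d := f`_n / lead_coef (p n).
  have l0 : lead_coef (p n) != 0 by rewrite lead_coef_eq0 -size_poly_gt0 size_p.
  have [|c hc] := ih (f - d *: p n).
    apply/leq_sizeP => j; rewrite leq_eqVlt => /predU1P[<-|nj].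
      rewrite coefB coefZ /d; have -> : (p n)`_n = lead_coef (p n).
        by rewrite /lead_coef size_p.
      by rewrite divfK ?subrr.
    rewrite coefB coefZ !nth_default ?mulr0 ?subr0// ?size_p//.
    exact: leq_trans fn _.
  exists (fun k => if k == n then d else c k); rewrite big_ord_recr /= eqxx.
  rewrite -[LHS](subrK (d *: p n)) hc; congr (_ + _); apply: eq_bigr => k _.
  by rewrite (ltn_eqF (ltn_ord k)).
rewrite {1}fc; apply: eq_bigr => j _; congr (_ *: _).
rewrite fc mulr_suml moment_fun_sum (bigD1 j) //= big1 ?addr0 => [|i ij].
  by rewrite -scalerAl moment_funZ p_orth eqxx mulr1.
by rewrite -scalerAl moment_funZ p_orth val_eqE (negbTE ij) mulr0.
Qed.

Lemma orth_low n f : (size f <= n)%N -> L (f * p n) = 0.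
Proof.
move=> fn; rewrite (orth_expansion fn) mulr_suml moment_fun_sum big1// => k _.
by rewrite -scalerAl moment_funZ p_orth (ltn_eqF (ltn_ord k)) mulr0.
Qed.

Definition jac_a n : R := L (p n * 'X * p n).
Definition jac_b n : R := L (p n * 'X * p n.+1).

Lemma size_pX n : size (p n * 'X) = n.+2.
Proof. by rewrite size_mulX ?size_p// -size_poly_gt0 size_p. Qed.

Lemma three_term0 : p 0 * 'X = jac_b 0 *: p 1 + jac_a 0 *: p 0.
Proof.
rewrite [LHS](@orth_expansion 2) ?size_pX//.
by rewrite !big_ord_recr big_ord0 /= add0r addrC.
Qed.

Lemma three_term n : p n.+1 * 'X =
  jac_b n.+1 *: p n.+2 + jac_a n.+1 *: p n.+1 + jac_b n *: p n.
Proof.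
rewrite [LHS](@orth_expansion n.+3) ?size_pX//.
rewrite !big_ord_recr /= big1 ?add0r => [|k _].
  have -> : L (p n.+1 * 'X * p n) = jac_b n by rewrite -mulrA mulrC [_ * p n]mulrC.
  by rewrite -/(jac_a _) -/(jac_b _) addrC addrA addrAC [_ + jac_b n *: _]addrC addrA.
by rewrite -mulrA mulrC ['X * _]mulrC orth_low ?scale0r// size_pX ltnS.
Qed.

Definition second n : {poly R} := T (p n).

Lemma second_threeterm n : second n.+1 * 'X =
  jac_b n.+1 *: second n.+2 + jac_a n.+1 *: second n.+1 + jac_b n *: second n.
Proof.
have := congr1 T (three_term n); rewrite second_polyMX.
have -> : L (p n.+1) = 0 by have := p_orth n.+1 0; rewrite p0 mulr1.
by rewrite addr0 /T !pextD !pextZ.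
Qed.

Lemma second0 : second 0 = 0.
Proof. by rewrite /second p0 second_polyC. Qed.

Lemma second1 : jac_b 0 *: second 1 = 1.
Proof.
have := congr1 T three_term0; rewrite second_polyMX /T pextD !pextZ.
rewrite -!/(T _) -/(second _) -/(second _) second0 mul0r add0r scaler0 addr0 => <-.
by have := p_orth 0 0; rewrite p0 mulr1 => ->.
Qed.

Lemma size_second n : s 0%N = 1 -> (n < size (second n.+1))%N.
Proof.
move=> s0.
have sm k : (size (second_monomial k) <= k)%N.
  elim: k => [|k ih] /=; first by rewrite size_poly0.
  rewrite (leq_trans (size_polyD _ _))// geq_max.
  rewrite (leq_trans (size_polyC_leq1 _))// andbT.
  by rewrite (leq_trans (size_polyMleq _ _))// size_polyX addn2 /= ltnS.
have lead k : (second_monomial k.+1)`_k = 1.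
  elim: k => [|k ih]; first by rewrite /= mul0r add0r coefC.
  by rewrite [second_monomial _]/= coefD coefMX coefC /= addr0 -[RHS]ih.
rewrite ltnNge; apply/negP => /leq_sizeP/(_ n (leqnn n)).
rewrite /second /T /pext size_p coef_sum big_ord_recr /= big1 => [|k _].
  have -> : (second_monomial n * 'X + (s n)%:P) = second_monomial n.+1 by [].
  rewrite add0r coefZ lead mulr1.
  have : lead_coef (p n.+1) != 0 by rewrite lead_coef_eq0 -size_poly_gt0 size_p.
  by rewrite /lead_coef size_p => /negP h /eqP.
rewrite coefZ [X in _ * X]nth_default ?mulr0//; apply: leq_trans (sm k) _.
by rewrite -ltnS.
Qed.

End Orthonormal.
End Moments.

(** * Integrals against a solution of the moment problem *)

Section HasIntegral.
Variable R : realType.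
Local Notation C := R[i].
Local Notation RT := (measurableTypeR R).
Variable lam : {measure set RT -> \bar R}.

Definition has_int (g : R -> R) (v : R) : Prop :=
  lam.-integrable setT (fun x : RT => (g x)%:E) /\ \int[lam]_x g x = v.

Lemma has_int_ext g h v : (forall x, g x = h x) -> has_int g v -> has_int h v.
Proof. by move=> /funext ->. Qed.

Lemma has_intD g h v w : has_int g v -> has_int h w ->
  has_int (fun x => g x + h x) (v + w).
Proof.
move=> [ig <-] [ih <-]; split; last exact: RintegralD.
by under eq_fun do rewrite EFinD; exact: integrableD.
Qed.

Lemma has_intZ c g v : has_int g v -> has_int (fun x => c * g x) (c * v).
Proof.
move=> [ig <-]; split; last exact: RintegralZl.
by under eq_fun do rewrite EFinM; exact: integrableZl.
Qed.

Lemma has_int_ge0 g v : (forall x, 0 <= g x) -> has_int g v -> 0 <= v.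
Proof. by move=> g0 [_ <-]; exact: Rintegral_ge0. Qed.

Lemma has_int0 : has_int (fun=> 0) 0.
Proof.
split; first exact: integrable0.
by rewrite /Rintegral integral0.
Qed.

Lemma has_int_sum n (g : nat -> R -> R) (v : nat -> R) :
  (forall k, has_int (g k) (v k)) ->
  has_int (fun x => \sum_(k < n) g k x) (\sum_(k < n) v k).
Proof.
move=> h; elim: n => [|n ih].
  rewrite big_ord0; apply: has_int_ext has_int0 => x; by rewrite big_ord0.
rewrite big_ord_recr /=; apply: has_int_ext (has_intD ih (h n)) => x.
by rewrite big_ord_recr.
Qed.

Definition chas_int (h : R -> C) (v : C) : Prop :=
  has_int (fun x => complex.Re (h x)) (complex.Re v) /\
  has_int (fun x => complex.Im (h x)) (complex.Im v).

Lemma chas_int_ext g h v : (forall x, g x = h x) -> chas_int g v -> chas_int h v.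
Proof. by move=> /funext ->. Qed.

Lemma chas_intD g h v w : chas_int g v -> chas_int h w ->
  chas_int (fun x => g x + h x) (v + w).
Proof.
move=> [g1 g2] [h1 h2]; split; rewrite ?ReD ?ImD.
  by apply: has_int_ext (has_intD g1 h1) => x; rewrite ReD.
by apply: has_int_ext (has_intD g2 h2) => x; rewrite ImD.
Qed.

Lemma chas_intZ c h v : chas_int h v -> chas_int (fun x => c * h x) (c * v).
Proof.
move=> [h1 h2]; split; rewrite ?ReM ?ImM.
  rewrite -mulNr; apply: has_int_ext (has_intD (has_intZ (complex.Re c) h1) (has_intZ (- complex.Im c) h2)) => x.
  by rewrite ReM mulNr.
apply: has_int_ext (has_intD (has_intZ (complex.Re c) h2) (has_intZ (complex.Im c) h1)) => x.
by rewrite ImM.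
Qed.

Definition cker (z : C) (x : R) : C := (x%:C - z)^-1.

Lemma cker_neq0 (z : C) (x : R) : complex.Im z != 0 -> x%:C - z != 0.
Proof.
move=> z0; rewrite subr_eq0; apply: contraNneq z0 => <-; by [].
Qed.

Lemma bounded_has_int (g : R -> R) (K : R) : (lam setT < +oo)%E ->
  continuous g -> (forall x, `|g x| <= K) -> exists v, has_int g v.
Proof.
move=> l1 cg gK; exists (\int[lam]_x g x); split => //.
apply: measurable_bounded_integrable => //.
  exact: continuous_measurable_fun.
exists K; split; first exact: num_real.
by move=> M KM x _; apply: le_trans (gK x) (ltW KM).
Qed.

Lemma cker_has_int (z : C) : (lam setT < +oo)%E -> complex.Im z != 0 ->
  exists W, chas_int (cker z) W.
Proof.
case: z => a b l1 /= b0; pose n x := (x - a) ^+ 2 + b ^+ 2.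
have b2 : 0 < b ^+ 2 by rewrite lt_def sqrf_eq0 b0 sqr_ge0.
have n0 x : 0 < n x by rewrite ltr_wpDl ?sqr_ge0.
have cn : continuous n.
  move=> x; apply: cvgD; last exact: cvg_cst.
  rewrite expr2; under eq_fun do rewrite expr2.
  by apply: (@cvgM R); apply: cvgB => //; exact: cvg_cst.
have cnV : continuous (fun x => (n x)^-1).
  by move=> x; apply: (@cvgV R) => //; [rewrite gt_eqF | exact: cn].
have bd (u v : R) : v ^+ 2 <= u ^+ 2 + b ^+ 2 -> `|v / (u ^+ 2 + b ^+ 2)| <= (1 + b ^- 2).
  move=> h; have m0 : 0 < u ^+ 2 + b ^+ 2 by rewrite ltr_wpDl ?sqr_ge0.
  rewrite normrM normfV [`|_ + _|]gtr0_norm// ler_pdivrMr//.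
  have h1 : 1 <= b ^- 2 * (u ^+ 2 + b ^+ 2).
    by rewrite mulrC ler_pdivlMr// mul1r lerDr sqr_ge0.
  have h2 : `|v| ^+ 2 <= u ^+ 2 + b ^+ 2 by rewrite real_normK ?num_real.
  by have := sqr_ge0 (`|v| - 1); rewrite mulrDl mul1r; nra.
have [v1 h1] : exists v, has_int (fun x => (x - a) / n x) v.
  apply: (@bounded_has_int _ (1 + b ^- 2)) => // [x|x].
    by apply: (@cvgM R); [apply: cvgB => //; exact: cvg_cst | exact: cnV].
  by apply: bd; rewrite lerDl sqr_ge0.
have [v2 h2] : exists v, has_int (fun x => b / n x) v.
  apply: (@bounded_has_int _ (1 + b ^- 2)) => // [x|x].
    by apply: (@cvgM R); [exact: cvg_cst | exact: cnV].
  by apply: bd; rewrite lerDr sqr_ge0.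
exists (v1 +i* v2); split.
  apply: has_int_ext h1 => x; rewrite ReV /normsq /n /=; congr (_ / (_ + _)).
  by ring.
apply: has_int_ext h2 => x; rewrite ImV /normsq /n /= add0r mulNr opprK.
by congr (_ / (_ + _)); ring.
Qed.

Section Moments.
Variable s : nat -> R.
Hypothesis lam_s : forall n, lam.-integrable setT (fun x : R => (x ^+ n)%:E) /\
  (\int[lam]_x (x ^+ n)%:E = (s n)%:E)%E.

Lemma has_int_poly (f : {poly R}) : has_int (fun x => f.[x]) (moment_fun s f).
Proof.
apply: has_int_ext (_ : has_int (fun x => \sum_(k < size f) f`_k * x ^+ k) _).
  by move=> x; rewrite horner_coef.
apply: (@has_int_sum _ (fun k x => f`_k * x ^+ k) (fun k => f`_k * s k)) => k.
by apply: has_intZ; have [h1 h2] := lam_s k; split; rewrite // /Rintegral h2.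
Qed.

Lemma lam_fin : (lam setT < +oo)%E.
Proof.
have [_] := lam_s 0; under eq_integral do rewrite expr0.
by rewrite integral_cst//= mul1e => ->; rewrite ltry.
Qed.

Lemma divided_difference_int (f : {poly R}) (z : C) :
  chas_int (divided_difference f z) (ceval (second_poly s f) z).
Proof.
have [A [B [h1 h2]]] := divided_difference_parts s f z.
rewrite h2; split => /=.
  by apply: has_int_ext (has_int_poly A) => x; rewrite h1.
by apply: has_int_ext (has_int_poly B) => x; rewrite h1.
Qed.

(** Splitting [f(x) = (f(x) - f(z)) + f(z)] gives both the integrability and the
    value, hence the Fourier coefficients of [cker z]. *)
Lemma cker_poly_int (f : {poly R}) (z W : C) : complex.Im z != 0 ->
  chas_int (cker z) W ->
  chas_int (fun x => f.[x]%:C * cker z x)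
    (ceval (second_poly s f) z + ceval f z * W).
Proof.
move=> z0 hW; have := chas_intD (divided_difference_int f z) (chas_intZ (ceval f z) hW).
apply: chas_int_ext => x; rewrite /cker /divided_difference.
have nz := cker_neq0 x z0; case: eqP => [zx|/eqP zx]; first by rewrite zx subrr eqxx in nz.
rewrite (ceval_real f); field.
by apply/andP; split; [exact: nz | rewrite subr_eq0; exact: zx].
Qed.

Section Bessel.
Variable p : nat -> {poly R}.
Hypothesis p_orth : forall n m, moment_fun s (p n * p m) = (n == m)%:R.

(** Stated for a pair of real functions because only the sum of the squares of
    the real and imaginary parts of [cker z] is a multiple of a function
    with known integral. *)
Lemma bessel (h1 h2 : R -> R) (c1 c2 : nat -> R) (E : R) n :
  has_int (fun x => h1 x ^+ 2 + h2 x ^+ 2) E ->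
  (forall k, has_int (fun x => (p k).[x] * h1 x) (c1 k)) ->
  (forall k, has_int (fun x => (p k).[x] * h2 x) (c2 k)) ->
  \sum_(k < n) (c1 k ^+ 2 + c2 k ^+ 2) <= E.
Proof.
move=> hE i1 i2.
pose H (c : nat -> R) := \sum_(k < n) c k *: p k.
have LH c : moment_fun s (H c * H c) = \sum_(k < n) c k ^+ 2.
  rewrite /H mulr_suml moment_fun_sum; apply: eq_bigr => i _.
  rewrite mulr_sumr moment_fun_sum (bigD1 i) //= big1 => [|j ji].
    by rewrite -scalerAl -scalerAr !moment_funZ p_orth eqxx mulr1 addr0 expr2.
  rewrite -scalerAl -scalerAr !moment_funZ p_orth [_ == _]eq_sym.
  by rewrite val_eqE (negbTE ji) !mulr0.
have HH c (x : R) : (H c).[x] = \sum_(k < n) c k * (p k).[x].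
  by rewrite /H horner_sum; apply: eq_bigr => k _; rewrite hornerZ.
have cross (h : R -> R) (c : nat -> R) :
    (forall k, has_int (fun x => (p k).[x] * h x) (c k)) ->
    has_int (fun x => h x * (H c).[x]) (\sum_(k < n) c k ^+ 2).
  move=> ic; have := has_int_sum n (fun k => has_intZ (c k) (ic k)).
  rewrite (eq_bigr (fun k : 'I_n => c k ^+ 2)); last by move=> k _; rewrite expr2.
  apply: has_int_ext => x; rewrite HH mulr_sumr; apply: eq_bigr => k _.
  by ring.
have := has_intD (has_intD hE (has_intZ (- 2) (has_intD (cross _ _ i1) (cross _ _ i2))))
  (has_intD (has_int_poly (H c1 * H c1)) (has_int_poly (H c2 * H c2))).
move/has_int_ge0; rewrite !LH -big_split /=.
set S := \sum_(i < n) _; move=> h.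
suff : 0 <= E + -2 * S + S by lra.
apply: h => x; rewrite !hornerM.
have := sqr_ge0 (h1 x - (H c1).[x]); have := sqr_ge0 (h2 x - (H c2).[x]).
by lra.
Qed.

(** The squared modulus of [cker z] is its imaginary part divided by [Im z],
    hence the right-hand side. *)
Lemma cker_bessel (z W : C) n : complex.Im z != 0 -> chas_int (cker z) W ->
  \sum_(k < n) normsq (ceval (second_poly s (p k)) z + ceval (p k) z * W) <=
  complex.Im W / complex.Im z.
Proof.
move=> z0 hW; have ik k := cker_poly_int (p k) z0 hW.
apply: (@bessel (fun x => complex.Re (cker z x)) (fun x => complex.Im (cker z x))
  (fun k => complex.Re (ceval (second_poly s (p k)) z + ceval (p k) z * W))
  (fun k => complex.Im (ceval (second_poly s (p k)) z + ceval (p k) z * W))).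
- have := has_intZ (complex.Im z)^-1 hW.2; rewrite mulrC.
  apply: has_int_ext => x; rewrite -/(normsq _) /cker normsqV ImV.
  have -> : complex.Im (x%:C - z) = - complex.Im z by case: (z) => a b /=; rewrite add0r.
  by rewrite mulNr opprK mulrA mulVf// mul1r.
- by move=> k; apply: has_int_ext (ik k).1 => x; rewrite ReM /= mul0r subr0.
- by move=> k; apply: has_int_ext (ik k).2 => x; rewrite ImM /= mul0r addr0.
Qed.

End Bessel.
End Moments.
End HasIntegral.

(** * A measure is determined by its Stieltjes transform *)

Section StieltjesUniqueness.
Variable R : realType.
Local Notation C := R[i].
Local Notation RT := (measurableTypeR R).
Variables (lam1 lam2 : {measure set RT -> \bar R}) (v1 : R).
Hypothesis int1 : has_int lam1 (fun=> 1) v1 /\ has_int lam2 (fun=> 1) v1.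
Hypothesis same_cker : forall z : C, complex.Im z != 0 ->
  exists W, chas_int lam1 (cker z) W /\ chas_int lam2 (cker z) W.

(** Partial fractions: a product with two distinct poles is a combination of two
    products with one pole less. *)
Lemma same_int_prod (zs : seq C) : uniq zs -> {in zs, forall z, complex.Im z != 0} ->
  exists W, chas_int lam1 (fun x => \prod_(z <- zs) cker z x) W /\
            chas_int lam2 (fun x => \prod_(z <- zs) cker z x) W.
Proof.
have [n] := ubnP (size zs); elim: n zs => // n ih [|z [|w zs]] /= sn us hz.
- exists v1%:C; have ext lam : has_int lam (fun=> 1) v1 ->
      chas_int lam (fun x => \prod_(z <- [::]) cker z x) v1%:C.
    move=> h; split; first by apply: has_int_ext h => x; rewrite big_nil.
    by apply: has_int_ext (has_int0 lam) => x; rewrite big_nil.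
  by split; apply: ext; case: int1.
- have [W [h1 h2]] := same_cker (hz z (mem_head _ _)); exists W.
  by split; [apply: chas_int_ext h1 | apply: chas_int_ext h2] => x; rewrite big_seq1.
have [zw uz uw] : [/\ z != w, uniq (z :: zs) & uniq (w :: zs)].
  move: us; rewrite /= in_cons negb_or -!andbA => /and4P[-> -> -> ->].
  by split.
have [|||W1 [h1 h2]] := ih (z :: zs) => //.
  by move=> y; rewrite in_cons => /orP[/eqP ->|h]; apply: hz; rewrite !in_cons ?eqxx// h !orbT.
have [|||W2 [g1 g2]] := ih (w :: zs) => //.
  by move=> y; rewrite in_cons => /orP[/eqP ->|h]; apply: hz; rewrite !in_cons ?eqxx ?h ?orbT.
have e x : (z - w)^-1 * (\prod_(y <- z :: zs) cker y x + -1 * \prod_(y <- w :: zs) cker y x) =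
    \prod_(y <- [:: z, w & zs]) cker y x.
  rewrite !big_cons /cker.
  have nz := cker_neq0 x (hz z (mem_head _ _)).
  have nw : x%:C - w != 0 by apply: cker_neq0; apply: hz; rewrite !in_cons eqxx orbT.
  by field; apply/and3P; split; [exact: nw|exact: nz|rewrite subr_eq0].
exists ((z - w)^-1 * (W1 + -1 * W2)).
split; apply: (chas_int_ext e); apply: chas_intZ; apply: chas_intD => //; exact: chas_intZ.
Qed.

(** The coefficient [n.+1] makes the limit vanish at the end points of the
    interval of centre [a] and radius [d]. *)
Definition bump (a d : R) (n : nat) (x : R) : R :=
  (1 + n.+1%:R * ((x - a) / d) ^+ (n.+1).*2)^-1.

(** The denominator is a polynomial with simple roots, none of them real, so
    that [same_int_prod] applies. *)
Lemma same_int_bump a d n : 0 < d -> exists v,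
  has_int lam1 (bump a d n) v /\ has_int lam2 (bump a d n) v.
Proof.
move=> d0; pose m := (n.+1).*2; pose c : C := (n.+1%:R * d^-1 ^+ m)%:C.
have c0 : c != 0.
  rewrite /c; have : n.+1%:R * d^-1 ^+ m != 0.
    by rewrite mulf_neq0 ?pnatr_eq0// expf_neq0// invr_eq0 gt_eqF.
  by apply: contra => /eqP/complexI ->.
pose P : {poly C} := c *: ('X - (a%:C)%:P) ^+ m + 1.
have Px (x : R) : P.[x%:C] = (1 + n.+1%:R * ((x - a) / d) ^+ m)%:C.
  rewrite /P hornerD hornerZ horner_exp hornerXsubC hornerC /c.
  rewrite -rmorphB -rmorphXn -rmorphM -(rmorph1 (real_complex R)) -rmorphD /=.
  by congr (_ %:C); rewrite exprMn; ring.
have Pge1 (x : R) : 1 <= 1 + n.+1%:R * ((x - a) / d) ^+ m.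
  by rewrite lerDl mulr_ge0// /m -mul2n exprM exprn_ge0 ?sqr_ge0.
have Px0 (x : R) : P.[x%:C] != 0.
  rewrite Px; apply/eqP => h; have := congr1 (@complex.Re R) h => /= h'.
  by have := Pge1 x; rewrite h' ler10.
have [zs Pzs] := closed_field_poly_normal P.
have P0 : P != 0 by apply: contraNneq (Px0 0) => ->; rewrite horner0.
have l0 : lead_coef P != 0 by rewrite lead_coef_eq0.
have dP : P^`() = (c * m%:R) *: ('X - (a%:C)%:P) ^+ m.-1.
  rewrite /P derivD derivC addr0 derivZ deriv_exp derivXsubC mul1r.
  by rewrite -scaler_nat scalerA.
have m0 : (m%:R : C) != 0 by rewrite pnatr_eq0.
have us : uniq zs.
  rewrite -separable_prod_XsubC.
  have : separable_poly P.
    (* [P - ('X - a) P' / m = 1] *)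
    rewrite unlock; apply/Bezout_coprimepP; exists (1, - (m%:R)^-1 *: ('X - (a%:C)%:P)).
    rewrite /= dP mul1r -scalerAl -scalerAr -exprS scalerA.
    have -> : - m%:R^-1 * (c * m%:R) = - c by rewrite mulrCA mulNr mulVf// mulrN1.
    by rewrite /P prednK// scaleNr addrAC subrr add0r eqpxx.
  by apply: dvdp_separable; rewrite Pzs dvdpZr.
have hz : {in zs, forall z, complex.Im z != 0}.
  move=> z zin; apply/eqP => z0; have zr : z = (complex.Re z)%:C.
    by case: z z0 {zin} => x y /= ->.
  have := Px0 (complex.Re z); rewrite -zr Pzs hornerZ horner_prod (big_rem z zin) /=.
  by rewrite hornerXsubC subrr mul0r mulr0 eqxx.
have [W [h1 h2]] := same_int_prod us hz.
have e x : (lead_coef P)^-1 * \prod_(z <- zs) cker z x = (bump a d n x)%:C.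
  have -> : (bump a d n x)%:C = P.[x%:C]^-1 by rewrite Px -fmorphV.
  rewrite [in RHS]Pzs hornerZ horner_prod invfM; congr (_ * _).
  by rewrite /cker prodfV; congr _^-1; apply: eq_bigr => z _; rewrite hornerXsubC.
exists (complex.Re ((lead_coef P)^-1 * W)).
by split; [have [h _] := chas_intZ (lead_coef P)^-1 h1 | have [h _] := chas_intZ (lead_coef P)^-1 h2];
  apply: has_int_ext h => x; rewrite e.
Qed.

Lemma bump_bound a d n x : 0 <= bump a d n x <= 1.
Proof.
have h : 1 <= 1 + n.+1%:R * ((x - a) / d) ^+ (n.+1).*2.
  by rewrite lerDl mulr_ge0// -mul2n exprM exprn_ge0 ?sqr_ge0.
rewrite /bump invr_ge0 (le_trans ler01 h)/= invf_le1//.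
exact: lt_le_trans ltr01 h.
Qed.

Lemma bump_cvg a d x : 0 < d ->
  bump a d n x @[n --> \oo] --> (\1_(`]a - d, a + d[%classic : set R) x : R).
Proof.
move=> d0; pose r := `|(x - a) / d|.
have r0 : 0 <= r by exact: normr_ge0.
have yr n : ((x - a) / d) ^+ (n.+1).*2 = r ^+ n.+1 * r ^+ n.+1.
  by rewrite -exprD addnn -mul2n !exprM /r real_normK ?num_real.
have mem : (`]a - d, a + d[%classic x) = (r < 1) :> Prop.
  rewrite /r normrM normfV (gtr0_norm d0) ltr_pdivrMr// mul1r.
  rewrite ltr_norml /= in_itv /=; congr is_true.
  by apply/idP/idP => /andP[h1 h2]; apply/andP; split; lra.
rewrite indicE; have [r1|r1] := ltP r 1; last first.
  have -> : (x \in `]a - d, a + d[%classic) = false.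
    by apply/negbTE; rewrite notin_setE mem ltNge r1.
  apply: (squeeze_cvgr _ (cvg_cst 0) (@cvg_harmonic R)).
  near=> n; have /andP[-> _] /= := bump_bound a d n x.
  rewrite /bump yr /= lef_pV2 ?posrE ?ltr0n//; last first.
    by rewrite ltr_pwDl// !mulr_ge0// exprn_ge0.
  rewrite -[leLHS]add0r lerD// ler_peMr// -exprD exprn_ege1//.
have -> : (x \in `]a - d, a + d[%classic) = true by apply/mem_set; rewrite mem.
(* one of the two factors [r ^+ n.+1] compensates [n.+1], by comparison with the
   geometric series; the other one gives the convergence *)
have nr n : n.+1%:R * r ^+ n.+1 <= (1 - r)^-1.
  have := @geometric_le_lim R n.+1 1 r ler01.
  have [->|rn0] := eqVneq r 0; first by rewrite expr0n mulr0 subr0 invr1.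
  rewrite lt_def rn0 r0 ger0_norm// mul1r => /(_ isT r1); apply: le_trans.
  rewrite seriesEord /= mulr_natl -[X in _ *+ X]card_ord -sumr_const.
  by apply: ler_sum => k _; rewrite mul1r ler_wiXn2l ?(ltW r1)// ltnW.
have lim : 1 - geometric (r * (1 - r)^-1) r n @[n --> \oo] --> (1 : R).
  rewrite -[X in _ --> X]subr0; apply: cvgB; first exact: cvg_cst.
  by apply: cvg_geometric; rewrite ger0_norm.
rewrite (_ : true%:R = 1 :> R)//.
apply: (squeeze_cvgr _ lim (cvg_cst (1 : R))).
near=> n; have /andP[_ ->] := bump_bound a d n x; rewrite andbT /= /bump yr.
set q := n.+1%:R * _.
have q0 : 0 <= q by rewrite !mulr_ge0// exprn_ge0.
have qle : q <= r / (1 - r) * r ^+ n.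
  have -> : r / (1 - r) * r ^+ n = (1 - r)^-1 * r ^+ n.+1.
    by rewrite [r / _]mulrC -mulrA -exprS.
  by rewrite /q mulrA ler_wpM2r// exprn_ge0.
apply: (@le_trans _ _ (1 - q)); first by rewrite lerB.
rewrite -[leRHS]mul1r ler_pdivlMr; last by lra.
by nra.
Unshelve. all: by end_near. Qed.

Lemma same_open_itv a d : 0 < d ->
  lam1 `]a - d, a + d[%classic = lam2 `]a - d, a + d[%classic.
Proof.
move=> d0; pose A : set RT := `]a - d, a + d[%classic.
have mA : measurable A by exact: measurable_itv.
have lim (lam : {measure set RT -> \bar R}) v : has_int lam (fun=> 1) v ->
    (forall n, exists w, has_int lam (bump a d n) w) ->
    (\int[lam]_x (bump a d n x)%:E @[n --> \oo] --> lam A)%E.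
  move=> [i1 _] ib.
  have -> : lam A = (\int[lam]_x (\1_A x)%:E)%E by rewrite integral_indic// setIT.
  apply: (@dominated_cvg _ RT R lam setT _ (fun n x => (bump a d n x)%:E) _ (fun=> 1%E)) => //.
  - by move=> n; have [w [/measurable_int]] := ib n.
  - move=> x _; apply: cvg_EFin; first exact: nearW.
    exact: bump_cvg.
  - by move=> n x _ /=; have /andP[h1 h2] := bump_bound a d n x; rewrite lee_fin ger0_norm.
have [hi1 hi2] := int1.
have l1 : (\int[lam1]_x (bump a d n x)%:E @[n --> \oo] --> lam1 A)%E.
  by apply: lim hi1 _ => n; have [w [h _]] := same_int_bump a n d0; exists w.
have l2 : (\int[lam2]_x (bump a d n x)%:E @[n --> \oo] --> lam2 A)%E.
  by apply: lim hi2 _ => n; have [w [_ h]] := same_int_bump a n d0; exists w.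
have e n : (\int[lam1]_x (bump a d n x)%:E = \int[lam2]_x (bump a d n x)%:E)%E.
  have [w [[i1 e1] [i2 e2]]] := same_int_bump a n d0.
  have f1 := integrable_fin_num measurableT i1.
  have f2 := integrable_fin_num measurableT i2.
  by rewrite -(fineK f1) -(fineK f2); congr (_%:E); rewrite -/(Rintegral _ _ _) e1 -e2.
have l1' : (\int[lam2]_x (bump a d n x)%:E @[n --> \oo] --> lam1 A)%E.
  by under eq_fun do rewrite -e.
exact: (cvg_unique _ l1' l2).
Qed.

(** Open intervals generate the Borel sets and are stable under intersection. *)
Lemma same_measure (A : set RT) : measurable A -> lam1 A = lam2 A.
Proof.
have fin1 : (lam1 setT < +oo)%E.
  have [[i1 _] _] := int1; have := integrable_fin_num measurableT i1.
  by rewrite integral_cst//= mul1e fin_num_abs => h; apply: le_lt_trans h; rewrite lee_abs.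
apply: (@measure_unique _ R RT (@RGenOpens.G R) (fun k : nat => `]0 - k.+1%:R, 0 + k.+1%:R[%classic)).
- exact: RGenOpens.measurableE.
- move=> _ _ [x [y ->]] [z [w ->]]; exists (Num.max x z), (Num.min y w).
  apply/seteqP; split => t; rewrite /= !in_itv /= gt_max lt_min.
    by move=> [/andP[-> ->] /andP[-> ->]].
  by move=> /andP[/andP[-> ->] /andP[-> ->]].
- by move=> k; eexists; eexists.
- apply/seteqP; split => // x _; exists (Num.trunc `|x|) => //=.
  by rewrite in_itv /= sub0r add0r -ltr_norml truncnS_gt.
- move=> _ [x [y ->]]; have [xy|yx] := ltP x y; last first.
    by rewrite set_itv_ge ?measure0// bnd_simp -leNgt.
  have := @same_open_itv ((x + y) / 2) ((y - x) / 2).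
  have -> : (x + y) / 2 - (y - x) / 2 = x by field.
  have -> : (x + y) / 2 + (y - x) / 2 = y by field.
  by apply; rewrite divr_gt0// subr_gt0.
- by move=> k; apply: le_lt_trans fin1; apply: le_measure; rewrite ?inE.
Qed.

End StieltjesUniqueness.

(** * Square summability in the indeterminate case *)

Section Transfer.
Variable R : realType.
Local Notation C := R[i].

Let N (z : C) : R := Num.sqrt (normsq z).

Let NE z : `|z| = (N z)%:C.
Proof. exact: normc_def. Qed.

Let N_ge0 z : 0 <= N z. Proof. exact: sqrtr_ge0. Qed.

Let N_sqr z : N z ^+ 2 = normsq z.
Proof. by rewrite sqr_sqrtr// normsq_ge0. Qed.

Let ND z w : N (z + w) <= N z + N w.
Proof. by rewrite -lecR rmorphD /= -!NE ler_normD. Qed.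

Let NM z w : N (z * w) = N z * N w.
Proof. by rewrite /N normsqM sqrtrM// normsq_ge0. Qed.

Let NN z : N (- z) = N z.
Proof. by rewrite /N normsqN. Qed.

(** Variation of constants: [y] is a combination of [P] and [Q] with
    coefficients the brackets of [y] with them. At each step these
    coefficients grow at most by the factor [1 + |u - z| r_k ^ 2], where
    [r_k] is square summable. *)
Lemma l2_transfer (a b : nat -> R) (z u : C) (P Q y : nat -> C) (M : R) :
  jacobi a b z P -> jacobi a b z Q -> jacobi a b u y ->
  (forall n, bracket b n P Q = - 1) ->
  (forall n, \sum_(k < n) normsq (P k) <= M) ->
  (forall n, \sum_(k < n) normsq (Q k) <= M) ->
  exists M', forall n, \sum_(k < n) normsq (y k) <= M'.
Proof.
move=> jP jQ jy PQ MP MQ.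
pose r k := N (P k) + N (Q k).
pose al n := bracket b n y Q; pose be n := bracket b n y P.
pose h n := N (al n) + N (be n).
have r0 k : 0 <= r k by rewrite addr_ge0.
have h0 n : 0 <= h n by rewrite addr_ge0.
have yE n : y n.+1 = Q n.+1 * be n - P n.+1 * al n.
  rewrite -[LHS]mulr1 -[1]opprK -(PQ n) /be /al /bracket; ring.
have yN n : N (y n.+1) <= r n.+1 * h n.
  rewrite yE; apply: le_trans (ND _ _) _; rewrite NN (NM (Q n.+1)) (NM (P n.+1)) /r /h.
  have g1 := mulr_ge0 (N_ge0 (P n.+1)) (N_ge0 (be n)).
  have g2 := mulr_ge0 (N_ge0 (Q n.+1)) (N_ge0 (al n)).
  by rewrite mulrDl !mulrDr; move: g1 g2; lra.
have hS n : h n.+1 <= h n * expR (N (u - z) * r n.+1 ^+ 2).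
  apply: (@le_trans _ _ (h n * (1 + N (u - z) * r n.+1 ^+ 2))); last first.
    by rewrite ler_wpM2l// expR_ge1Dx.
  rewrite {1}/h /al /be (bracketS n jy jQ) (bracketS n jy jP) -/(al n) -/(be n).
  have h1 := ND (al n) ((u - z) * (y n.+1 * Q n.+1)).
  have h2 := ND (be n) ((u - z) * (y n.+1 * P n.+1)).
  rewrite !(NM (u - z)) !(NM (y n.+1)) in h1 h2.
  have h3 : N (u - z) * (N (y n.+1) * r n.+1) <= N (u - z) * (r n.+1 * h n * r n.+1).
    by rewrite ler_wpM2l// ler_wpM2r.
  apply: (le_trans (lerD h1 h2)).
  have -> : h n * (1 + N (u - z) * r n.+1 ^+ 2) = h n + N (u - z) * (r n.+1 * h n * r n.+1) by ring.
  apply: le_trans (lerD (lexx (h n)) h3); rewrite /h /r; lra.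
pose S n := \sum_(k < n) r k ^+ 2.
have SM n : S n <= 4 * M.
  have : S n <= \sum_(k < n) (2 * normsq (P k) + 2 * normsq (Q k)).
    apply: ler_sum => k _; rewrite /r -!N_sqr.
    by have := sqr_ge0 (N (P k) - N (Q k)); lra.
  move/le_trans; apply; rewrite big_split -!mulr_sumr /=.
  by have := MP n; have := MQ n; lra.
have hexp n : h n <= h 0 * expR (N (u - z) * S n.+1).
  elim: n => [|n ih].
    rewrite -[leLHS]mulr1 ler_wpM2l// -expR0 ler_expR mulr_ge0//.
    by rewrite sumr_ge0// => k _; exact: sqr_ge0.
  apply: le_trans (hS n) _; rewrite /S big_ord_recr /= -/(S n.+1) mulrDr expRD mulrA.
  by rewrite ler_wpM2r// expR_ge0.
pose H := h 0 * expR (N (u - z) * (4 * M)).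
have hH n : h n <= H.
  apply: (le_trans (hexp n)); rewrite ler_wpM2l// ler_expR ler_wpM2l//.
have H0 : 0 <= H by exact: le_trans (hH 0%N).
exists (normsq (y 0) + 4 * M * H ^+ 2) => n.
have M0 : 0 <= M by have := MP 0%N; rewrite big_ord0.
case: n => [|n]; first by rewrite big_ord0 addr_ge0 ?normsq_ge0// !mulr_ge0// sqr_ge0.
rewrite big_ord_recl lerD2l.
apply: (@le_trans _ _ (S n.+1 * H ^+ 2)); last by rewrite ler_wpM2r// sqr_ge0.
rewrite /S mulr_suml big_ord_recl /= -[leLHS]add0r lerD ?mulr_ge0 ?sqr_ge0//.
apply: ler_sum => k _; rewrite -N_sqr -exprMn ler_sqr ?nnegrE ?mulr_ge0//.
by apply: (le_trans (yN _)); rewrite ler_wpM2l.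
Qed.

End Transfer.

Section Indeterminate.
Variables (R : realType) (s : nat -> R).
Local Notation C := R[i].
Local Notation RT := (measurableTypeR R).

(** Otherwise [same_measure] would identify the two measures. *)
Lemma indeterminate_cker : indeterminate s ->
  exists lam1 lam2 : {measure set RT -> \bar R}, exists z W1 W2 : C,
    [/\ moment_solution s lam1, moment_solution s lam2, complex.Im z != 0 &
        [/\ chas_int lam1 (cker z) W1, chas_int lam2 (cker z) W2 & W1 != W2]].
Proof.
move=> [lam1 [lam2 [[i1 h1] [i2 h2] [A [mA nA]]]]]; exists lam1, lam2.
apply: contrapT => hn; apply: nA.
have one (lam : {measure set RT -> \bar R}) : (forall n, lam.-integrable setT (fun x : R => (x ^+ n)%:E) /\
    (\int[lam]_x (x ^+ n)%:E = (s n)%:E)%E) -> has_int lam (fun=> 1) (moment_fun s 1%:P).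
  by move=> h; apply: has_int_ext (has_int_poly h 1%:P) => x; rewrite hornerC.
apply: (same_measure (conj (one _ h1) (one _ h2))) => // z z0.
have [W1 w1] := cker_has_int (lam_fin h1) z0.
have [W2 w2] := cker_has_int (lam_fin h2) z0.
exists W1; split => //; suff -> : W1 = W2 by [].
by apply: contrapT => /eqP W12; apply: hn; exists z, W1, W2; split.
Qed.

Variable p : nat -> {poly R}.
Hypothesis p0 : p 0%N = 1.
Hypothesis size_p : forall n, size (p n) = n.+1.
Hypothesis p_orth : forall n m, moment_fun s (p n * p m) = (n == m)%:R.

Let q := second s p.
Let a := jac_a s p.
Let b := jac_b s p.

Lemma sol_jacobi t u : jacobi a b u (sol p q t u).
Proof.
move=> n; have cZ c (f : {poly R}) : ceval (c *: f) u = c%:C * ceval f u.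
  by rewrite -mul_polyC cevalM cevalC.
suff h (f : nat -> {poly R}) :
    f n.+1 * 'X = b n.+1 *: f n.+2 + a n.+1 *: f n.+1 + b n *: f n ->
    (b n.+1)%:C * ceval (f n.+2) u =
      (u - (a n.+1)%:C) * ceval (f n.+1) u - (b n)%:C * ceval (f n) u.
  rewrite /sol; case: t; apply: h; first exact: three_term.
  exact: second_threeterm.
move=> /(congr1 (fun f => ceval f u)); rewrite cevalM cevalX !cevalD !cZ => h.
by rewrite mulrBl [u * _]mulrC h; ring.
Qed.

Lemma ceval_p1 u : (b 0)%:C * ceval (p 1) u = u - (a 0)%:C.
Proof.
have := congr1 (fun f => ceval f u) (three_term0 size_p p_orth).
rewrite p0 mul1r alg_polyC cevalX cevalD cevalC -mul_polyC cevalM cevalC => h.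
by rewrite [in RHS]h addrK.
Qed.

Lemma ceval_q1 u : (b 0)%:C * ceval (q 1) u = 1.
Proof.
have := congr1 (fun f => ceval f u) (second1 p0 size_p p_orth).
by rewrite -mul_polyC cevalM !cevalC.
Qed.

(** The difference of the Fourier coefficients with respect to the two measures
    is [(W1 - W2)] times the value of the orthonormal polynomial. *)
Lemma l2_solutions : indeterminate s -> forall t u, exists M : R, forall n,
  \sum_(k < n) normsq (sol p q t u k) <= M.
Proof.
move=> /indeterminate_cker[lam1 [lam2 [z [W1 [W2 [[_ h1] [_ h2] z0 [w1 w2 W12]]]]]]].
have B1 n := cker_bessel h1 p_orth n z0 w1.
have B2 n := cker_bessel h2 p_orth n z0 w2.
set E1 := _ / _ in B1; set E2 := _ / _ in B2.
have dW : 0 < normsq (W1 - W2) by rewrite normsq_gt0 subr_eq0.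
pose MP := (2 * E1 + 2 * E2) / normsq (W1 - W2).
have hP n : \sum_(k < n) normsq (ceval (p k) z) <= MP.
  rewrite ler_pdivlMr// mulr_suml.
  apply: le_trans (lerD (ler_wpM2l (ler0n R 2) (B1 n)) (ler_wpM2l (ler0n R 2) (B2 n))).
  rewrite !mulr_sumr -big_split; apply: ler_sum => k _ /=.
  rewrite -normsqM; set P := ceval (p k) z; set Q := ceval (second_poly _ _) z.
  have -> : P * (W1 - W2) = (Q + P * W1) - (Q + P * W2) by ring.
  by apply: le_trans (normsq_le2 _ _) _; rewrite normsqN.
pose MQ := 2 * E1 + 2 * (MP * normsq W1).
have hQ n : \sum_(k < n) normsq (ceval (q k) z) <= MQ.
  apply: le_trans (lerD (ler_wpM2l (ler0n R 2) (B1 n))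
    (ler_wpM2l (ler0n R 2) (ler_wpM2r (normsq_ge0 W1) (hP n)))).
  rewrite mulr_suml !mulr_sumr -big_split; apply: ler_sum => k _ /=.
  rewrite -normsqM -[normsq (_ * W1)]normsqN.
  by apply: le_trans (normsq_le2 _ _); rewrite addrK.
move=> t u; apply: (l2_transfer (sol_jacobi true z) (sol_jacobi false z)
  (sol_jacobi t u) _ (M := Num.max MP MQ)).
- move=> n; rewrite (bracket_sol sol_jacobi p0 (second0 s p0) ceval_p1 ceval_q1).
  by rewrite subrr mul0r addr0 /jump sub0r rmorphN1.
- by move=> n; rewrite le_max hP.
- by move=> n; rewrite le_max hQ orbT.
Qed.

End Indeterminate.

(** * The four Nevanlinna functions *)

Lemma second_kindE (R : realType) (s : nat -> R)
    (mu : {measure set (measurableTypeR R) -> \bar R}) (p : nat -> {poly R}) n z :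
  moment_solution s mu -> second_kind mu p n z = ceval (second s p n) z.
Proof.
move=> [_ h]; have [[_ e1] [_ e2]] := divided_difference_int h (p n) z.
rewrite /second_kind /cintegral e1 e2 /second; by case: (ceval _ _).
Qed.

Unset Implicit Arguments.

Theorem theorem1p3 (R : realType) (s : nat -> R)
    (mu : {measure set (measurableTypeR R) -> \bar R})
    (p : nat -> {poly R}) (F : R[i] -> R[i] -> R[i]) (v : R[i]) :
  s 0%N = 1 ->
  indeterminate s ->
  moment_solution s mu ->
  orthonormal_polys mu p ->
  [\/ F = nevanlinnaA mu p, F = nevanlinnaB mu p,
      F = nevanlinnaC mu p | F = nevanlinnaD p] ->
  [/\ (zero_section F v #= [set: nat])%card,
      (complex.Im v = 0 -> zero_section F v `<=` [set u | complex.Im u = 0]),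
      (0 < complex.Im v -> zero_section F v `<=` [set u | 0 < complex.Im u]) &
      (complex.Im v < 0 -> zero_section F v `<=` [set u | complex.Im u < 0])].
Proof.
move=> s0 ind sol_mu [p0 size_p _ orth] hF; have [_ h] := sol_mu.
have p_orth n m : moment_fun s (p n * p m) = (n == m)%:R.
  have [_ <-] := has_int_poly h (p n * p m).
  under eq_Rintegral do rewrite hornerM.
  by rewrite /Rintegral orth.
pose q := second s p.
have [t [t' ->]] : exists t t', F = nevF p q t t'.
  have ext G H : (forall u w, G u w = H u w) -> G = H :> (R[i] -> R[i] -> R[i]).
    by move=> e; apply/funext => u; apply/funext => w.
  have Q n z : second_kind mu p n z = ceval (q n) z by exact: second_kindE.
  case: hF => ->; [exists false, false|exists true, false|exists false, true|exists true, true];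
    apply: ext => u w; rewrite /nevF /jump ?subrr ?subr0 ?sub0r ?rmorphN1 ?rmorph1 ?rmorph0 ?add0r;
    congr (_ * _) || congr (_ + _ * _); congr cseries; apply/funext => k; by rewrite ?Q.
exact: (nevF_zeros (sol_jacobi p0 size_p p_orth) p0 (second0 s p0)
  (ceval_p1 p0 size_p p_orth) (ceval_q1 p0 size_p p_orth)
  (fun n => eq_leq (esym (size_p n))) (fun n => size_second size_p n s0)
  (l2_solutions p0 size_p p_orth ind)).
Qed.
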